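(* Let $\mathbf{a}=(a_1,a_2)\in\mathbb{R}^2$ be a pair of constants, regarded as a pair of constant functions in $\mathbf{E}=L^2_{\mathbb R}(0,1)\times L^2_{\mathbb R}(0,1)$, and assume $\mathbf{a}\in\mathbf{W}$, i.e. both operators $L_1(\mathbf{a})$ and $L_2(\mathbf{a})$ have only simple eigenvalues. Then there exists $\varepsilon>0$ such that, whenever $\mathbf{p}_1=(p_1,q_1)$ and $\mathbf{p}_2=(p_2,q_2)$ belong to $B(\mathbf{a},\varepsilon)$ and satisfy $\lambda_n(\mathbf{p}_1)=\lambda_n(\mathbf{p}_2)$ and $\mu_n(\mathbf{p}_1)=\mu_n(\mathbf{p}_2)$ for all $n\ge 1$, the following hold: (1) if $q_1(x)=q_2(x)$ a.e. on $(0,1)$, then $p_1(x)=p_2(x)$ a.e. on $(0,1)$; (2) if $p_1(x)=p_2(x)$ a.e. on $(0,1)$, then $q_1(x)=q_2(x)$ a.e. on $(0,1)$.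
   Context: $L^2_{\mathbb R}(0,1)$ is the space of real-valued square-integrable functions on $(0,1)$; $\mathbf{E}=L^2_{\mathbb R}(0,1)\times L^2_{\mathbb R}(0,1)$ carries the product (Hilbert) norm $\|\cdot\|$, and $B(\mathbf{a},\varepsilon)$ is the ball of radius $\varepsilon$ about $\mathbf{a}$ in $\mathbf{E}$. For $\mathbf{p}=(p,q)\in\mathbf{E}$, consider the closed sesquilinear form $\mathfrak{q}_{\mathbf p}[y,z]=(y'',z'')+(py',z')+(qy,z)$, where $(\cdot,\cdot)$ is the inner product of $L^2(0,1)$. $L_1(\mathbf{p})$ is the operator in $L^2(0,1)$ associated (by the form representation theorem) with $\mathfrak{q}_{\mathbf p}$ on the domain $\mathcal{Q}_1=\{y\in H^2[0,1]: y(0)=y(1)=0\}$, and $L_2(\mathbf{p})$ is the operator associated with $\mathfrak{q}_{\mathbf p}$ on the domain $\mathcal{Q}_2=\{y\in H^2[0,1]: y(0)=y'(1)=0\}$. For smooth coefficients these are the operators generated by $y^{(4)}-(py')'+qy=\lambda y$ with boundary conditions $y(0)=y''(0)=y(1)=y''(1)=0$ (Dirichlet) and $y(0)=y''(0)=y'(1)=y'''(1)=0$ (Dirichlet-Neumann), respectively. Both operators are self-adjoint, bounded below, with discrete spectrum. $\{\lambda_n(\mathbf{p})\}_{n\ge1}$ and $\{\mu_n(\mathbf{p})\}_{n\ge 1}$ denote the (entire) spectra of $L_1(\mathbf{p})$ and $L_2(\mathbf{p})$, respectively, listed in nondecreasing order with multiplicity. $\mathbf{W}$ is the set of $\mathbf{p}\in\mathbf{E}$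 such that $L_1(\mathbf{p})$ and $L_2(\mathbf{p})$ have only simple eigenvalues. *)

(* Defs.v *)
From HB Require Import structures.
From mathcomp Require Import all_boot all_order all_algebra.
From mathcomp Require Import all_classical all_reals all_analysis.
From mathcomp Require Import complex.

Set Implicit Arguments.
Unset Strict Implicit.
Unset Printing Implicit Defensive.

Import Order.TTheory GRing.Theory Num.Theory.
Import numFieldNormedType.Exports.

Local Open Scope classical_set_scope.
Local Open Scope ring_scope.
Local Open Scope complex_scope.

(* Elements of the L^2 spaces are represented by functions on the whole line
   of which only the values on (0,1), up to a.e. equality, are relevant. *)

Definition I01 (R : realType) : set R := `]0, 1[.
Arguments I01 {R}.

Definition ae01 (R : realType) (T : Type) (f g : R -> T) : Prop :=
  f = g %[ae @lebesgue_measure R in I01].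

(* [f \_ I01] is the extension of f by 0 outside (0,1). *)
Definition realL2 (R : realType) (f : R -> R) : Prop :=
  f \_ I01 \in Lfun (@lebesgue_measure R) 2%:E.

Definition realL2norm (R : realType) (f : R -> R) : R :=
  fine 'N[@lebesgue_measure R]_2%:E[EFin \o (f \_ I01)].

Definition potentials (R : realType) : Type := ((R -> R) * (R -> R))%type.

Definition inE2 (R : realType) (p : potentials R) : Prop :=
  realL2 p.1 /\ realL2 p.2.

Definition E2norm (R : realType) (p : potentials R) : R :=
  Num.sqrt (realL2norm p.1 ^+ 2 + realL2norm p.2 ^+ 2).

Definition E2ball (R : realType) (a : potentials R) (eps : R) :
    set (potentials R) :=
  [set p | inE2 p /\ E2norm (p.1 \- a.1, p.2 \- a.2) < eps].

Definition L2 (R : realType) (f : R -> R[i]) : Prop :=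
  realL2 (fun x => complex.Re (f x)) /\ realL2 (fun x => complex.Im (f x)).

Definition L2norm (R : realType) (f : R -> R[i]) : R :=
  Num.sqrt (realL2norm (fun x => complex.Re (f x)) ^+ 2
            + realL2norm (fun x => complex.Im (f x)) ^+ 2).

Definition Cintegral (R : realType) (D : set R) (f : R -> R[i]) : R[i] :=
  Rintegral (@lebesgue_measure R) D (fun x => complex.Re (f x))
  +i* Rintegral (@lebesgue_measure R) D (fun x => complex.Im (f x)).

Definition inner (R : realType) (f g : R -> R[i]) : R[i] :=
  Cintegral I01 (fun x => f x * (g x)^*).

(* H^2[0,1]: y and y' are absolutely continuous on [0,1], that is, indefinite
   Lebesgue integrals of their derivatives, and y'' is square-integrable.
   y and y' are the continuous representatives on the closed interval. *)
Record H2 (R : realType) : Type := MkH2 {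
  H2fun : R -> R[i];
  H2d1 : R -> R[i];
  H2d2 : R -> R[i];
  H2d2_L2 : L2 H2d2;
  H2d1_primitive : forall x : R, 0 <= x <= 1 ->
    H2d1 x = H2d1 0 + Cintegral `]0, x[ H2d2;
  H2fun_primitive : forall x : R, 0 <= x <= 1 ->
    H2fun x = H2fun 0 + Cintegral `]0, x[ H2d1 }.

Definition quad_form (R : realType) (p : potentials R) (y z : H2 R) : R[i] :=
  inner (H2d2 y) (H2d2 z)
  + inner (fun x => (p.1 x)%:C * H2d1 y x) (H2d1 z)
  + inner (fun x => (p.2 x)%:C * H2fun y x) (H2fun z).

Definition Q1 (R : realType) : set (H2 R) :=
  [set y | H2fun y 0 = 0 /\ H2fun y 1 = 0].

Definition Q2 (R : realType) : set (H2 R) :=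
  [set y | H2fun y 0 = 0 /\ H2d1 y 1 = 0].

(* An unbounded operator T in L^2(0,1) is given by its graph: [T u f] means
   that u is in the domain of T and that T u = f; both up to a.e. equality. *)
Definition operator (R : realType) : Type :=
  (R -> R[i]) -> (R -> R[i]) -> Prop.

(* The operator of the representation theorem: y in Q is in the domain, with
   image f, iff quad_form p y z = (f, z) for all z in Q. *)
Definition form_operator (R : realType) (Q : set (H2 R)) (p : potentials R) :
    operator R :=
  fun u f => [/\ L2 u, L2 f &
    exists y : H2 R, [/\ Q y, ae01 u (H2fun y) &
      forall z : H2 R, Q z -> quad_form p y z = inner f (H2fun z)]].

Definition L_1 (R : realType) (p : potentials R) : operator R :=
  form_operator (@Q1 R) p.

Definition L_2 (R : realType) (p : potentials R) : operator R :=
  form_operator (@Q2 R) p.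

Definition eigspace (R : realType) (T : operator R) (z : R[i]) :
    set (R -> R[i]) :=
  [set u | T u (fun x => z * u x)].

Definition is_eigenvalue (R : realType) (T : operator R) (z : R[i]) : Prop :=
  exists2 u, eigspace T z u & ~ ae01 u (fun=> 0).

(* Dimension of the eigenspace, as a subspace of L^2(0,1). *)
Definition has_multiplicity (R : realType) (T : operator R) (z : R[i])
    (m : nat) : Prop :=
  exists e : 'I_m -> R -> R[i],
    (forall i, eigspace T z (e i)) /\
    (forall u, eigspace T z u ->
       exists! c : {ffun 'I_m -> R[i]},
         ae01 u (fun x => \sum_(i < m) c i * e i x)).

Definition only_simple_eigenvalues (R : realType) (T : operator R) : Prop :=
  forall z : R[i], is_eigenvalue T z -> has_multiplicity T z 1.

(* T - z is a bijection of its domain onto L^2(0,1) with bounded inverse;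
   injectivity is contained in the norm bound. *)
Definition resolvent_set (R : realType) (T : operator R) : set R[i] :=
  [set z |
    (forall f, L2 f -> exists u, T u (fun x => f x + z * u x)) /\
    (exists M : R, forall u f, L2 f -> T u (fun x => f x + z * u x) ->
       L2norm u <= M * L2norm f)].

Definition spectrum (R : realType) (T : operator R) : set R[i] :=
  ~` resolvent_set T.

(* [l] lists the whole spectrum of T in nondecreasing order, each point being
   repeated according to its multiplicity; [l n] is the (n+1)-st element. *)
Definition spectrum_listing (R : realType) (T : operator R) (l : nat -> R) :
    Prop :=
  [/\ forall n, l n <= l n.+1,
      spectrum T = [set (l n)%:C | n in [set: nat]] &
      forall n, exists2 m, has_multiplicity T (l n)%:C m &
                           ([set k | l k = l n] #= `I_m)%card].

Definition W (R : realType) : set (potentials R) :=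
  [set p | [/\ inE2 p, only_simple_eigenvalues (L_1 p) &
               only_simple_eigenvalues (L_2 p)]].
Arguments W {R}.

(* Main.v *)
(** Put [kap j k = pi (k + j/2)], so that the constant coefficient operators have
    the eigenvalues [Lam k = kap^4 + a1 kap^2 + a2] with eigenfunctions
    [sin (kap x)]. Simplicity of these eigenvalues gives a gap
    [|Lam k - Lam n| >= gam |k - n| max (kap k) (kap n) ^ 3].

    Let [y] solve [(L (p, q) - lam) y = alpha sin (kap n x)] with [lam] near
    [Lam n]. Testing the equation with the sines bounds the other Fourier
    coefficients of [y], and Bessel's inequality together with the gap shows that,
    once its n-th coefficient is normalized, [y' / kap n] and [y] are within
    [O (eps / n)] of [cos (kap n x)] and [sin (kap n x)] in sup norm. Taking
    [alpha = 1], this also shows that [lam - Lam n] cannot range over a whole real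
    interval of the resolvent set: each operator has a spectral point near each
    [Lam n]. Hence isospectral operators share an eigenvalue near [Lam n],
    whatever the numbering, with eigenfunctions [y] and [z] close to the same sine.

    Testing each eigenvalue equation with the other eigenfunction gives
    [int (p1 - p2) y' z' + (q1 - q2) y z = 0]. If [q1 = q2], then
    [f = p1 - p2] is orthogonal to functions within [O (eps / m)] of
    [1 + cos (pi m x)], [m >= 1], both spectra being needed to get all [m]; if
    [p1 = p2], the same holds with [f = q1 - q2] and [1 - cos (pi m x)]. Letting
    [m] tend to infinity gives [int f = 0]; then all cosine coefficients of [f]
    are [O (eps / m) ||f||], and Parseval's identity forces [f = 0]. *)

Require Import Defs.
From mathcomp Require Import all_boot all_order all_algebra.
From mathcomp Require Import all_classical all_reals all_analysis.
From mathcomp Require Import measurable_realfun.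
From mathcomp Require Import complex.
From mathcomp Require Import ring lra.

Set Implicit Arguments.
Unset Strict Implicit.
Unset Printing Implicit Defensive.

Import Order.TTheory GRing.Theory Num.Theory.
Import numFieldNormedType.Exports.

Local Open Scope classical_set_scope.
Local Open Scope ring_scope.

(** * Square-integrable functions on the unit interval *)

Section IntegralUnitInterval.
Context {R : realType}.
Implicit Types (f g h : R -> R) (c M : R).
Local Notation mu := (@lebesgue_measure R).

Definition intble f : Prop := mu.-integrable I01 (EFin \o f).
Definition rint f : R := \int[mu]_(x in I01) f x.
Definition ip f g : R := rint (f \* g).

Lemma addfE f g x : (f + g) x = f x + g x. Proof. by []. Qed.

Lemma oppfE f x : (- f) x = - f x. Proof. by []. Qed.

Lemma scalefE c f x : (c *: f) x = c * f x. Proof. by []. Qed.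

Lemma measurable_I01 : measurable (I01 : set (measurableTypeR R)).
Proof. exact: measurable_itv. Qed.
Hint Resolve measurable_I01 : core.

Lemma intbleD f g : intble f -> intble g -> intble (f + g).
Proof. by move=> If Ig; exact: (integrableD measurable_I01 If Ig). Qed.

Lemma intbleZ c f : intble f -> intble (c *: f).
Proof. by move=> If; exact: (integrableZl measurable_I01 c If). Qed.

Lemma rintD f g : intble f -> intble g -> rint (f + g) = rint f + rint g.
Proof. by move=> If Ig; exact: RintegralD. Qed.

Lemma rintZ c f : intble f -> rint (c *: f) = c * rint f.
Proof. by move=> If; exact: RintegralZl. Qed.

Lemma eq_in_rint f g : (forall x : R, 0 < x < 1 -> f x = g x) -> rint f = rint g.
Proof.
move=> fg; apply: eq_Rintegral => x; rewrite inE /I01 /= in_itv/=; exact: fg.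
Qed.

Lemma le_rint f g : intble f -> intble g ->
  (forall x : R, 0 < x < 1 -> f x <= g x) -> rint f <= rint g.
Proof.
by move=> If Ig fg; apply: le_Rintegral => // x; rewrite /I01 /= in_itv/=; exact: fg.
Qed.

Lemma rint_ge0 f : (forall x, 0 <= f x) -> 0 <= rint f.
Proof. by move=> f0; apply: Rintegral_ge0. Qed.

Lemma rint_cst c : rint (fun=> c) = c.
Proof. rewrite /rint Rintegral_cst// [X in fine X](lebesgue_measure_itv `]0, 1[)/=
  lte_fin ltr01.
by rewrite oppr0 adde0 mulr1. Qed.

Lemma intble_bounded f M : measurable_fun I01 f ->
  (forall x : R, 0 < x < 1 -> `|f x| <= M) -> intble f.
Proof.
move=> mf fM; apply: measurable_bounded_integrable => //.
  by rewrite [X in (X < _)%E](lebesgue_measure_itv `]0, 1[)/= lte_fin ltr01 ltry.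
exists M; split; first by rewrite num_real.
move=> x Mx y; rewrite /I01 /= in_itv/= => /fM; move/le_trans; apply; exact: ltW.
Qed.

Lemma le_intble f g : measurable_fun I01 f -> intble g ->
  (forall x : R, 0 < x < 1 -> `|f x| <= g x) -> intble f.
Proof.
move=> mf Ig fg; apply: (le_integrable measurable_I01 _ _ Ig);
  first exact/measurable_EFinP.
move=> x; rewrite /I01 /= in_itv/= => /fg fgx; rewrite lee_fin.
by rewrite (le_trans fgx) // ler_norm.
Qed.

(** Replaces membership of the zero extension in [Lfun] by a condition on [I01] itself, the form in
    which integrability is checked below. *)
Lemma realL2P f : realL2 f <-> measurable_fun I01 f /\ intble (f \* f).
Proof.
have E : EFin \o (fun x => (f \_ I01) x ^+ 2) = ((EFin \o (f \* f)) \_ I01).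
  apply/funext => x /=; rewrite !patchE; case: ifP => //= _.
  by rewrite expr0n.
rewrite /realL2; split.
  move=> Lf; have := Lfun2_integrable_sqr Lf; rewrite E => If; split.
    apply/(measurable_restrictT _ measurable_I01).
    by move: Lf; rewrite inE => /andP[+ _]; rewrite inE.
  have [_ /(_ If)] := integrable_restrict mu measurable_I01 measurableT (EFin \o (f
    \* f)).
  by rewrite setTI.
move=> [mf If]; rewrite inE; apply/andP; split; rewrite inE/=.
  exact/(measurable_restrictT _ measurable_I01).
rewrite /finite_norm unlock /Lnorm poweR_lty//.
have : mu.-integrable setT ((EFin \o (f \* f)) \_ I01).
  by apply/(integrable_restrict mu measurable_I01 measurableT); rewrite setTI.
rewrite -E => /integrableP[_]; apply: le_lt_trans.
under eq_integral => x _ do rewrite /= (@powR_mulrn R `|(f \_ I01) x| 2) //.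
by under [leRHS]eq_integral => x _ do rewrite /= normrX.
Qed.

Lemma realL2_meas f : realL2 f -> measurable_fun I01 f.
Proof. by case/realL2P. Qed.

(** The product is dominated by [f ^ 2 + g ^ 2], since [(|f| - |g|) ^ 2 >= 0]. *)
Lemma ip_intble f g : realL2 f -> realL2 g -> intble (f \* g).
Proof.
move=> /realL2P[mf If] /realL2P[mg Ig].
apply: (@le_intble _ (f \* f + g \* g)).
- exact: measurable_funM.
- exact: intbleD.
- move=> x _ /=; rewrite normrM.
  have := sqr_ge0 (`|f x| - `|g x|).
  have -> : (f \* f + g \* g) x = `|f x| ^+ 2 + `|g x| ^+ 2.
    by rewrite /= !real_normK ?num_real// !expr2.
  have := normr_ge0 (f x); have := normr_ge0 (g x); nra.
Qed.

Lemma realL2D f g : realL2 f -> realL2 g -> realL2 (f + g).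
Proof.
move=> Lf Lg; apply/realL2P; split.
  by apply: measurable_funD; exact: realL2_meas.
have -> : (f + g) \* (f + g) = f \* f + (f \* g + (f \* g + g \* g)).
  by apply/funext => x; rewrite /= !(addfE, scalefE) /=; ring.
by do !apply: intbleD => //; exact: ip_intble.
Qed.

Lemma realL2Z c f : realL2 f -> realL2 (c *: f).
Proof.
move=> Lf; apply/realL2P; split.
  by apply: measurable_funM => //; exact: realL2_meas.
have -> : (c *: f) \* (c *: f) = (c * c) *: (f \* f).
  by apply/funext => x; rewrite /= !(addfE, scalefE) /=; ring.
by apply: intbleZ; exact: ip_intble.
Qed.

Lemma realL2N f : realL2 f -> realL2 (- f).
Proof. by move=> Lf; rewrite -scaleN1r; exact: realL2Z. Qed.

Lemma realL2B f g : realL2 f -> realL2 g -> realL2 (f - g).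
Proof. by move=> Lf Lg; apply: realL2D => //; exact: realL2N. Qed.

Lemma realL2_bounded f M : measurable_fun I01 f ->
  (forall x : R, 0 < x < 1 -> `|f x| <= M) -> realL2 f.
Proof.
move=> mf fM; apply/realL2P; split => //.
apply: (@intble_bounded _ (M * M)); first exact: measurable_funM.
by move=> x /fM fMx /=; rewrite normrM ler_pM.
Qed.

Lemma realL2_cst c : realL2 (fun=> c).
Proof. by apply: (@realL2_bounded _ `|c|). Qed.

Lemma realL2_sum (I : Type) (s : seq I) (P : pred I) (F : I -> R -> R) :
  (forall i, P i -> realL2 (F i)) -> realL2 (\sum_(i <- s | P i) F i).
Proof.
move=> LF; elim/big_ind : _ => //; first exact: (realL2_cst 0).
by move=> f g; exact: realL2D.
Qed.

Lemma realL2M_bounded f g M : measurable_fun I01 f ->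
  (forall x : R, 0 < x < 1 -> `|f x| <= M) -> realL2 g -> realL2 (f \* g).
Proof.
move=> mf fM /realL2P[mg Ig]; apply/realL2P; split; first exact: measurable_funM.
apply: (@le_intble _ ((M * M) *: (g \* g))).
- by apply: measurable_funM; exact: measurable_funM.
- exact: intbleZ.
- move=> x /fM fMx /=; rewrite mulrACA normrM !normrM.
  by rewrite [X in _ <= X](_ : _ = (M * M) * (`|g x| * `|g x|)) ?ler_pM//
    -normrM ger0_norm// -expr2 sqr_ge0.
Qed.

Lemma intbleL2 f : realL2 f -> intble f.
Proof.
move=> Lf; rewrite (_ : f = f \* (fun=> 1)).
  by apply: ip_intble => //; exact: realL2_cst.
by apply/funext => x /=; rewrite mulr1.
Qed.

Lemma ipC f g : ip f g = ip g f.
Proof. by congr rint; apply/funext => x /=; rewrite mulrC. Qed.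

Lemma ipDl f g h : realL2 f -> realL2 g -> realL2 h ->
  ip (f + g) h = ip f h + ip g h.
Proof.
move=> Lf Lg Lh; rewrite /ip -rintD; [|exact: ip_intble|exact: ip_intble].
by congr rint; apply/funext => x /=; rewrite mulrDl.
Qed.

Lemma ipZl c f g : realL2 f -> realL2 g -> ip (c *: f) g = c * ip f g.
Proof.
move=> Lf Lg; rewrite /ip -rintZ; last exact: ip_intble.
by congr rint; apply/funext => x; rewrite /= -[LHS]mulrA.
Qed.

Lemma ipNl f g : realL2 f -> realL2 g -> ip (- f) g = - ip f g.
Proof. by move=> Lf Lg; rewrite -scaleN1r ipZl// mulN1r. Qed.

Lemma ipBl f g h : realL2 f -> realL2 g -> realL2 h ->
  ip (f - g) h = ip f h - ip g h.
Proof. by move=> Lf Lg Lh; rewrite ipDl ?ipNl//; exact: realL2N. Qed.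

Lemma ipDr f g h : realL2 f -> realL2 g -> realL2 h ->
  ip h (f + g) = ip h f + ip h g.
Proof. by move=> *; rewrite ipC ipDl// ![ip h _]ipC. Qed.

Lemma ipZr c f g : realL2 f -> realL2 g -> ip g (c *: f) = c * ip g f.
Proof. by move=> *; rewrite ipC ipZl// [ip g _]ipC. Qed.

Lemma ipBr f g h : realL2 f -> realL2 g -> realL2 h ->
  ip h (f - g) = ip h f - ip h g.
Proof. by move=> *; rewrite ipC ipBl// ![ip h _]ipC. Qed.

Lemma ip0l f : ip 0 f = 0.
Proof.
rewrite /ip (_ : _ \* _ = fun=> 0) ?rint_cst//.
by apply/funext => x /=; rewrite mul0r.
Qed.

Lemma ip_suml (I : Type) (s : seq I) (P : pred I) (F : I -> R -> R) g :
  (forall i, P i -> realL2 (F i)) -> realL2 g ->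
  ip (\sum_(i <- s | P i) F i) g = \sum_(i <- s | P i) ip (F i) g.
Proof.
move=> LF Lg; elim: s => [|i s IH]; first by rewrite !big_nil ip0l.
rewrite !big_cons; case: ifP => // Pi; rewrite ipDl ?IH//; first exact: LF.
exact: realL2_sum.
Qed.

Lemma ip_ge0 f : 0 <= ip f f.
Proof. by apply: rint_ge0 => x /=; rewrite -expr2 sqr_ge0. Qed.

Lemma ip_sqrB f g : realL2 f -> realL2 g ->
  ip (f - g) (f - g) = ip f f - 2 * ip f g + ip g g.
Proof.
move=> Lf Lg; have LB := realL2B Lf Lg.
by rewrite ipBl// !ipBr// (ipC g f); ring.
Qed.

(** The square norm of [f - t g] is nonnegative for every real [t]. *)
Lemma cauchy_schwarz f g : realL2 f -> realL2 g ->
  ip f g ^+ 2 <= ip f f * ip g g.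
Proof.
move=> Lf Lg.
have H t : 0 <= ip f f - 2 * (t * ip f g) + t * (t * ip g g).
  have := ip_ge0 (f - t *: g); rewrite ip_sqrB//; last exact: realL2Z.
  by rewrite ipZr// ipZl ?ipZr//; exact: realL2Z.
have := ip_ge0 g; rewrite le_eqVlt => /predU1P[g0|g0].
  rewrite -g0 mulr0; have [->|fg0] := eqVneq (ip f g) 0; first by rewrite expr0n.
  (* When [ip g g = 0] the quadratic in [t] is affine; this [t] would give it the value -1. *)
  have := H ((ip f f + 1) / (2 * ip f g)); rewrite -g0 !mulr0 addr0.
  rewrite (_ : 2 * _ = ip f f + 1) ?opprD ?addrA ?subrr ?sub0r ?ler0N1//.
  by field.
have := H (ip f g / ip g g); have g0' := lt0r_neq0 g0.
rewrite (_ : _ + _ = ip f f - ip f g ^+ 2 / ip g g); last by field.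
by rewrite subr_ge0 ler_pdivrMr.
Qed.

(** Links the norm that defines the ball [E2ball] to the form [ip] used in all estimates. *)
Lemma realL2norm_sqr f : realL2 f -> realL2norm f ^+ 2 = ip f f.
Proof.
move=> /realL2P[mf If]; rewrite /realL2norm.
have -> : ('N[mu]_2%:E[EFin \o f \_ I01] = (ip f f)%:E `^ 2^-1)%E.
  rewrite unlock /Lnorm; congr (_ `^ _)%E.
  rewrite /ip /rint /Rintegral fineK; last exact: integrable_fin_num.
  rewrite [RHS]integral_mkcond; apply: eq_integral => x _ /=.
  rewrite (@powR_mulrn R `|(f \_ I01) x| 2) // real_normK ?num_real//.
  by rewrite !patchE; case: ifP => //= _; rewrite expr0n.
rewrite poweR_EFin/= -powR_mulrn ?powR_ge0// -powRrM mulVf ?powRr1//.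
exact: ip_ge0.
Qed.

Lemma ip_eq0_ae f : realL2 f -> ip f f = 0 -> ae01 f (fun=> 0).
Proof.
move=> /realL2P[mf If] ff0.
have : (\int[mu]_(x in I01) `|((f \* f)%R x)%:E| = 0)%E.
  rewrite -[RHS]/(0%:E) -ff0 /ip /rint /Rintegral fineK; last first.
    exact: integrable_fin_num.
  apply: eq_integral => x _ /=; rewrite ger0_norm//.
  by rewrite -expr2 sqr_ge0.
have [+ _] := ae_eq_integral_abs mu measurable_I01 (measurable_int _ If).
move=> /[apply].
apply: filterS => x H xI; have := H xI => /= /eqP.
by rewrite eqe -expr2 sqrf_eq0 => /eqP.
Qed.

Lemma ae_eq_rint f g : measurable_fun I01 f -> measurable_fun I01 g ->
  ae01 f g -> rint f = rint g.
Proof.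
move=> mf mg fg; rewrite /rint /Rintegral; congr fine.
apply: ae_eq_integral => //; [exact/measurable_EFinP..|].
move: fg; apply: filterS; first exact: (ae_filter_ringOfSetsType mu).
by move=> x H xI; rewrite (H xI).
Qed.

End IntegralUnitInterval.
#[export] Hint Resolve measurable_I01 : core.

(** * Uniform approximation by cosine polynomials *)

Section UniformApproximation.
Context {R : realType}.
Implicit Types (f g h : R -> R) (c M : R).

Definition clamp (x : R) : R := if x <= 0 then 0 else if 1 <= x then 1 else x.

Lemma clamp_itv x : 0 <= clamp x <= 1.
Proof. by rewrite /clamp; case: (leP x 0) => ?; case: (leP 1 x) => ?; lra. Qed.

Lemma clamp_id (x : R) : 0 <= x <= 1 -> clamp x = x.
Proof. by rewrite /clamp; case: (leP x 0) => ?; case: (leP 1 x) => ?; lra. Qed.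

Lemma clamp_lip x y : `|clamp x - clamp y| <= `|x - y|.
Proof.
rewrite /clamp; case: (ler0P (x - y)) => ?; rewrite ler_norml;
  by case: (leP x 0) => ?; case: (leP 1 x) => ?; case: (leP y 0) => ?;
     case: (leP 1 y) => ?; lra.
Qed.

Lemma lipschitz_continuous f c : (forall x y, `|f x - f y| <= c * `|x - y|) ->
  continuous f.
Proof.
move=> fl x; apply/cvgrPdist_lt => e e0; near=> y.
apply: (le_lt_trans (fl x y)).
have c1 : c < `|c| + 1 by rewrite (le_lt_trans (ler_norm c))// ltrDl.
have c0 : 0 < `|c| + 1 by rewrite ltr_pwDr.
apply: (@le_lt_trans _ _ ((`|c| + 1) * `|x - y|)).
  by rewrite ler_wpM2r// ltW.
rewrite -ltr_pdivlMl//; near: y.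
apply/nbhs_ballP; exists ((`|c| + 1)^-1 * e) => //=.
by rewrite mulr_gt0// invr_gt0.
Unshelve. all: by end_near. Qed.

Lemma continuous_clamp : continuous clamp.
Proof. by apply: (@lipschitz_continuous _ 1) => x y; rewrite mul1r clamp_lip. Qed.

(* Continuity of the restriction of f to [0, 1], through the continuous extension
   of that restriction that is constant on both sides. *)
Definition cont01 f : Prop := continuous (f \o clamp).

Lemma within_cont01 f : {within `[0, 1], continuous f} -> cont01 f.
Proof.
move=> /subspace_continuousP cf x.
have cx : `[0, 1]%classic (clamp x) by rewrite /= in_itv/= clamp_itv.
apply: cvg_comp (cf _ cx) => A /= /continuous_clamp wA.
have {}wA : \forall y \near x, `[0, 1]%classic (clamp y) -> A (clamp y) by [].
apply: filterS wA => y H; apply: H.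
by rewrite /= in_itv/= clamp_itv.
Qed.

Lemma continuous_cont01 f : continuous f -> cont01 f.
Proof. by move=> cf x; apply: continuous_comp (cf _); exact: continuous_clamp. Qed.

Lemma eq_cont01 f g : (forall x, 0 <= x <= 1 -> f x = g x) -> cont01 f -> cont01 g.
Proof.
move=> fg; rewrite /cont01 (_ : g \o clamp = f \o clamp)//.
by apply/funext => x /=; rewrite fg// clamp_itv.
Qed.

Lemma cont01_meas f : cont01 f -> measurable_fun I01 f.
Proof.
move=> cf; apply: (@eq_measurable_fun _ _ _ _ _ (f \o clamp)).
  move=> x; rewrite inE /I01/= in_itv/= => /andP[x0 x1].
  by rewrite clamp_id// !ltW.
apply: measurable_funTS; exact: continuous_measurable_fun.
Qed.

Lemma cont01_sup f : cont01 f ->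
  exists2 x0, 0 <= x0 <= 1 & forall x, 0 <= x <= 1 -> `|f x| <= `|f x0|.
Proof.
move=> cf; have cn : {within `[0, 1], continuous (fun x => `|(f \o clamp) x|)}.
  apply: continuous_subspaceT => x; apply: continuous_comp; first exact: cf.
  exact: norm_continuous.
have [x0 + H] := EVT_max ler01 cn; rewrite in_itv/= => x0I.
exists x0 => // x xI; have := H x; rewrite in_itv/= => /(_ xI).
by rewrite !clamp_id.
Qed.

Lemma cont01_realL2 f : cont01 f -> realL2 f.
Proof.
move=> cf; have [x0 _ H] := cont01_sup cf.
apply: (realL2_bounded (cont01_meas cf)) => x /andP[x0' x1].
by apply: H; rewrite !ltW.
Qed.

Lemma cont01_realL2M f g : cont01 f -> realL2 g -> realL2 (f \* g).
Proof.
move=> cf; have [x0 _ H] := cont01_sup cf.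
apply: (realL2M_bounded (cont01_meas cf)) => x /andP[x0' x1].
by apply: H; rewrite !ltW.
Qed.

Lemma cont01D f g : cont01 f -> cont01 g -> cont01 (f + g).
Proof. by move=> cf cg x; exact: (cvgD (cf x) (cg x)). Qed.

Lemma cont01M f g : cont01 f -> cont01 g -> cont01 (f \* g).
Proof. by move=> cf cg x; exact: (cvgM (cf x) (cg x)). Qed.

Lemma cont01Z c f : cont01 f -> cont01 (c *: f).
Proof. by move=> cf x; exact: (cvgM (cvg_cst c) (cf x)). Qed.

Lemma cont01_cst c : cont01 (fun=> c).
Proof. by apply: continuous_cont01 => x; exact: cvg_cst. Qed.

Lemma cont01B f g : cont01 f -> cont01 g -> cont01 (f - g).
Proof. by move=> cf cg x; exact: (cvgB (cf x) (cg x)). Qed.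

Lemma cont01_sum (I : Type) (s : seq I) (P : pred I) (F : I -> R -> R) :
  (forall i, cont01 (F i)) -> cont01 (\sum_(i <- s | P i) F i).
Proof.
move=> cF; elim/big_ind : _ => // [|f g]; last exact: cont01D.
rewrite /cont01 (_ : 0 \o clamp = cst 0); first exact: cst_continuous.
by apply/funext.
Qed.

(** Heine's theorem from compactness in near-covering form, the filter variable being a modulus [d]
    tending to 0 from the right. *)
Lemma cont01_unif f : cont01 f -> forall e : R, 0 < e -> exists2 d : R, 0 < d &
  forall x y : R, 0 <= x <= 1 -> 0 <= y <= 1 -> `|x - y| < d -> `|f x - f y| < e.
Proof.
move=> cf e e0; set F := f \o clamp.
have e2 : 0 < e / 2 by rewrite divr_gt0.
have nc := (compact_near_coveringP _).1 (@segment_compact R 0 1).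
have /nc : forall x : R, `[0, 1]%classic x -> \forall x' \near x & d \near (0:R)^'+,
    forall y, `|x' - y| < d -> `|F x' - F y| < e.
  move=> x _; have /cvgrPdist_lt/(_ _ e2) := cf x.
  rewrite -/F => /nbhs_ballP[r/= r0 xr].
  have r2 : 0 < r / 2 by rewrite divr_gt0.
  exists (ball x (r / 2), [set d | d < r / 2]); first split => /=.
  - exact: nbhsx_ballx.
  - exact: nbhs_right_lt.
  move=> [x' d]/= [xx' dr] y x'y.
  have Fx' : `|F x - F x'| < e / 2.
    apply: xr; rewrite /ball/=; apply: (lt_trans xx'); lra.
  have Fy : `|F x - F y| < e / 2.
    apply: xr; rewrite /ball/= (_ : x - y = (x - x') + (x' - y)); last by ring.
    rewrite (le_lt_trans (ler_normD _ _))// [r]splitr ltrD//.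
    exact: lt_trans dr.
  rewrite (_ : F x' - F y = (F x - F y) - (F x - F x')); last by ring.
  by rewrite (le_lt_trans (ler_normB _ _))// [e]splitr ltrD.
move=> /nbhs_ballP[r/= r0 H].
exists (r / 2); first by rewrite divr_gt0.
move=> x y xI yI xy; have r20 : 0 < r / 2 by rewrite divr_gt0.
have := H (r / 2); rewrite /ball/= sub0r normrN gtr0_norm//.
move=> /(_ _ r20 x _ y xy); rewrite /F/= !clamp_id//; apply.
  by rewrite ltr_pdivrMr// ltr_pMr//; lra.
by rewrite /= in_itv.
Qed.

(* bern c N g is the expectation of g at a binomial variable of parameters
   (N, c); for g k = f (k / N) it is the Bernstein polynomial of f. *)
Fixpoint bern c (N : nat) (g : nat -> R) : R :=
  if N is n.+1 then c * bern c n (g \o S) + (1 - c) * bern c n g else g 0%N.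

(** For [c] in [0, 1] each step of [bern] is a convex combination, so pointwise bounds pass to
    expectations. *)
Lemma bern_dist c N (g w : nat -> R) v : 0 <= c <= 1 ->
  (forall k, (k <= N)%N -> `|g k - v| <= w k) -> `|bern c N g - v| <= bern c N w.
Proof.
move=> c01; elim: N g w => [|N IH] g w gw /=; first exact: gw.
have H1 := IH (g \o S) (w \o S) (fun k kN => gw k.+1 kN).
have H2 := IH g w (fun k kN => gw k (leqW kN)).
rewrite [X in `|X|](_ : _ = c * (bern c N (g \o S) - v) + (1 - c) * (bern c N g -
  v)); last by ring.
rewrite (le_trans (ler_normD _ _))// !normrM ger0_norm ?(ger0_norm (_ : 0 <= 1 - c));
  try lra.
by rewrite lerD// ler_wpM2l//; lra.
Qed.

Lemma bern_affine c N (h : nat -> R) a b :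
  bern c N (fun k => a + b * h k) = a + b * bern c N h.
Proof.
elim: N h => //= N IH h; rewrite (IH h).
by have := IH (h \o S); rewrite /comp /= => ->; ring.
Qed.

(** Second moment of a shifted binomial variable: square of the mean plus the variance
    [N c (1 - c)]. *)
Lemma bern_sqr c N a :
  bern c N (fun k => (k%:R + a) ^+ 2) = (N%:R * c + a) ^+ 2 + N%:R * c * (1 - c).
Proof.
elim: N a => [|N IH] a /=; first by ring.
rewrite IH (_ : _ \o _ = fun k => (k%:R + (a + 1)) ^+ 2) ?IH.
  by rewrite -[in RHS]natr1; ring.
by apply/funext => k /=; rewrite -natr1; congr (_ ^+ 2); ring.
Qed.

(** The quadratic error has expectation [C c (1 - c) / N], because [k / N] has mean [c] and variance
    [c (1 - c) / N]. *)
Lemma bern_approx c N (g : nat -> R) v e C : 0 <= c <= 1 -> (0 < N)%N -> 0 <= C ->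
  (forall k, (k <= N)%N -> `|g k - v| <= e + C * (k%:R / N%:R - c) ^+ 2) ->
  `|bern c N g - v| <= e + C / N%:R.
Proof.
move=> c01 N0 C0 H; have N0' : 0 < N%:R :> R by rewrite ltr0n.
apply: (le_trans (bern_dist (w := fun k => e + C / N%:R ^+ 2 * (k%:R + - (N%:R * c))
  ^+ 2) c01 _)).
  move=> k /H; congr (_ <= _ + _).
  by field; rewrite lt0r_neq0.
rewrite bern_affine bern_sqr addrN expr0n/= add0r lerD2l.
rewrite [X in X <= _](_ : _ = C / N%:R * (c * (1 - c))); last first.
  by field; rewrite lt0r_neq0.
rewrite -[leRHS]mulr1 ler_wpM2l ?divr_ge0//; nra.
Qed.

(** * Linear spans and cosine polynomials *)

Definition spn (phi : nat -> R -> R) f : Prop :=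
  exists N (t : nat -> R), f = \sum_(k < N) t k *: phi k.

Lemma spn_gen phi m : spn phi (phi m).
Proof.
exists m.+1, (fun k => (k == m)%:R).
rewrite (bigD1 ord_max)//= eqxx scale1r big1 ?addr0// => i /eqP im.
case: eqP => [E|_]; last by rewrite scale0r.
by exfalso; apply: im; exact: val_inj.
Qed.

Lemma spnZ phi c f : spn phi f -> spn phi (c *: f).
Proof.
move=> [N [t ->]]; exists N, (fun k => c * t k).
by rewrite scaler_sumr; apply: eq_bigr => i _; rewrite scalerA.
Qed.

Lemma spnD phi f g : spn phi f -> spn phi g -> spn phi (f + g).
Proof.
move=> [N [t ->]] [M [s ->]].
exists (maxn N M), (fun k => (if (k < N)%N then t k else 0) + (if (k < M)%N then s k
  else 0)).
rewrite (big_ord_widen (maxn N M) (fun k => t k *: phi k)) ?leq_maxl//.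
rewrite (big_ord_widen (maxn N M) (fun k => s k *: phi k)) ?leq_maxr//.
rewrite big_mkcond/= [X in _ + X]big_mkcond -big_split/=.
apply: eq_bigr => i _; rewrite scalerDl.
by congr (_ + _); case: ifP; rewrite ?scale0r.
Qed.

Lemma spn0 phi : spn phi 0.
Proof. by exists 0%N, (fun=> 0); rewrite big_ord0. Qed.

Lemma spn_ind phi (P : (R -> R) -> Prop) : P 0 ->
  (forall f g, P f -> P g -> P (f + g)) -> (forall c m, P (c *: phi m)) ->
  forall f, spn phi f -> P f.
Proof. by move=> P0 PD Pg f [N [t ->]]; elim/big_ind : _ => // i _; exact: Pg. Qed.

Definition cosm (m : nat) (x : R) : R := cos (pi * m%:R * x).

(** By the product formula [2 cos a cos b = cos (a + b) + cos (a - b)]; hence every polynomial in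
    [cos (pi x)] is a cosine polynomial. *)
Lemma spn_cosM f : spn cosm f -> spn cosm (cosm 1 \* f).
Proof.
elim/spn_ind => [|g h Sg Sh|c m].
- rewrite (_ : _ \* _ = 0); first exact: spn0.
  by apply/funext => x /=; rewrite mulr0.
- rewrite (_ : _ \* _ = cosm 1 \* g + cosm 1 \* h); first exact: spnD.
  by apply/funext => x /=; rewrite mulrDr.
- case: m => [|m].
    rewrite (_ : _ \* _ = c *: cosm 1); first by apply: spnZ; exact: spn_gen.
    apply/funext => x; rewrite /= !scalefE {2}/cosm mulr0 mul0r cos0; ring.
  rewrite (_ : _ \* _ = (c / 2) *: (cosm m.+2 + cosm m)).
    by apply: spnZ; apply: spnD; exact: spn_gen.
  apply/funext => x; rewrite /= !scalefE !addfE /cosm.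
  rewrite (_ : pi * m.+2%:R * x = pi * m.+1%:R * x + pi * 1 * x); last first.
    by rewrite -(natr1 m.+1); ring.
  rewrite (_ : pi * m%:R * x = pi * m.+1%:R * x - pi * 1 * x); last first.
    by rewrite -(natr1 m); ring.
  by rewrite cosD cosB; field.
Qed.

(** This is [sin (pi x / 2) ^ 2], a change of variable of [0, 1] that turns polynomials into cosine
    polynomials. *)
Let cc (x : R) : R := (1 - cosm 1 x) / 2.

Lemma spn_bern N (g : nat -> R) : spn cosm (fun x => bern (cc x) N g).
Proof.
elim: N g => [|N IH] g /=.
  rewrite (_ : (fun=> _) = g 0%N *: cosm 0); first by apply: spnZ; exact: spn_gen.
  by apply/funext => x; rewrite scalefE /cosm mulr0 mul0r cos0 mulr1.
set A := fun x => bern (cc x) N (g \o S); set B := fun x => bern (cc x) N g.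
rewrite (_ : (fun=> _) = 2^-1 *: (A + B) + (2^-1 *: (cosm 1 \* B) + (- 2^-1) *: (cosm
  1 \* A))).
  apply: spnD; first by apply: spnZ; apply: spnD; exact: IH.
  by apply: spnD; apply: spnZ; apply: spn_cosM; exact: IH.
apply/funext => x; by rewrite !(addfE, scalefE)/= /A /B /cc; field.
Qed.

Lemma cc_itv x : 0 <= cc x <= 1.
Proof. by rewrite /cc /cosm; have := cos_geN1 (pi * 1 * x);
  have := cos_le1 (pi * 1 * x); lra. Qed.

Lemma cc_surj (c : R) : 0 <= c <= 1 -> exists2 x, 0 <= x <= 1 & cc x = c.
Proof.
move=> c01; have c1 : -1 <= 1 - 2 * c <= 1 by lra.
exists (acos (1 - 2 * c) / pi).
  rewrite divr_ge0 ?acos_ge0 ?pi_ge0//= ler_pdivrMr ?pi_gt0// mul1r.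
  exact: acos_lepi.
rewrite /cc /cosm (_ : pi * 1 * _ = acos (1 - 2 * c)).
  by rewrite acosK ?in_itv//=; field.
by rewrite mulr1 mulrC divfK// gt_eqF ?pi_gt0.
Qed.

(** On [0, 2] the function [sin (pi t / 2)] is symmetric about 1 and increases up to 1, so on
    [[d, 2 - d]] its minimum is at the ends. *)
Lemma sin_pihalf_ge (d t : R) : 0 < d -> d <= t <= 2 - d -> d <= 1 ->
  sin (pi / 2 * d) <= sin (pi / 2 * t).
Proof.
move=> d0 dt d1.
have p0 : 0 < pi / 2 :> R by rewrite divr_gt0 ?pi_gt0.
have mono s : d <= s <= 1 -> sin (pi / 2 * d) <= sin (pi / 2 * s).
  move=> ds; rewrite leNgt ltr_sin; first by rewrite -leNgt ler_pM2l//; lra.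
    by rewrite in_itv/=; nra.
  by rewrite in_itv/=; nra.
have [t1|t1] := leP t 1; first by apply: mono; lra.
have -> : sin (pi / 2 * t) = sin (pi / 2 * (2 - t)).
  rewrite (_ : pi / 2 * (2 - t) = pi - pi / 2 * t); last by field.
  by rewrite sinB sinpi cospi; ring.
by apply: mono; lra.
Qed.

(** Quantitative injectivity of [cc]: the difference factors as [sin (pi (x + y) / 2) sin (pi (x -
    y) / 2)], and both factors are at least [sin (pi d / 2)] when [x - y >= d]. *)
Lemma cc_sep (d : R) : 0 < d -> d <= 1 -> exists2 m : R, 0 < m &
  forall x y, 0 <= x <= 1 -> 0 <= y <= 1 -> d <= `|x - y| -> m <= `|cc x - cc y|.
Proof.
move=> d0 d1; set s := sin (pi / 2 * d).
have s0 : 0 < s.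
  by apply: sin_gt0_pi; have := pi_gt0 R => p0; apply/andP; split; nra.
exists (s * s); first by rewrite mulr_gt0.
suff H x y : 0 <= x <= 1 -> 0 <= y <= 1 -> d <= x - y -> s * s <= `|cc x - cc y|.
  move=> x y xI yI; case: (ler0P (x - y)) => xy; last exact: H.
  by move=> dxy; rewrite distrC; apply: H => //; lra.
move=> xI yI dxy.
rewrite (_ : cc x - cc y = sin (pi / 2 * (x + y)) * sin (pi / 2 * (x - y))).
  have h1 : s <= sin (pi / 2 * (x + y)) by apply: sin_pihalf_ge => //; lra.
  have h2 : s <= sin (pi / 2 * (x - y)) by apply: sin_pihalf_ge => //; lra.
  rewrite ger0_norm ?ler_pM ?mulr_ge0//; lra.
rewrite /cc /cosm (_ : pi * 1 * x = pi / 2 * (x + y) + pi / 2 * (x - y)); last by field.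
rewrite (_ : pi * 1 * y = pi / 2 * (x + y) - pi / 2 * (x - y)); last by field.
by rewrite cosD cosB; field.
Qed.

(** Bernstein's argument in the variable [cc x]. Points closer than [d] change [f] by less than
    [e / 2]; for the others the crude bound [2 M] is at most [C (cc x - cc y) ^ 2]. Then
    [bern_approx] applies with [C / N <= e / 2]. *)
Lemma cos_dense_unif f (e : R) : cont01 f -> 0 < e ->
  exists2 T, spn cosm T & forall x, 0 <= x <= 1 -> `|f x - T x| <= e.
Proof.
move=> cf e0; have e2 : 0 < e / 2 by rewrite divr_gt0.
have [d0 d00 Hd0] := cont01_unif cf e2.
have [d [dp d1 Hd]] : exists d : R, [/\ 0 < d, d <= 1 & forall x y : R, 0 <= x <= 1 ->
    0 <= y <= 1 -> `|x - y| < d -> `|f x - f y| < e / 2].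
  exists (Num.min d0 1); split; rewrite ?lt_min ?d00 ?ltr01 ?ge_min ?lexx ?orbT//.
  by move=> x y xI yI; rewrite lt_min => /andP[xy _]; exact: Hd0.
have [m m0 Hm] := cc_sep dp d1.
have [xm xmI HM] := cont01_sup cf; set M : R := `|f xm| in HM.
have M0 : 0 <= M by exact: normr_ge0.
set C := 2 * M / m ^+ 2.
have C0 : 0 <= C by rewrite divr_ge0 ?sqr_ge0// mulr_ge0.
have modu x y : 0 <= x <= 1 -> 0 <= y <= 1 ->
    `|f x - f y| <= e / 2 + C * (cc x - cc y) ^+ 2.
  move=> xI yI; have [xy|xy] := ltP `|x - y| d.
    by rewrite (le_trans (ltW (Hd _ _ xI yI xy)))// lerDl mulr_ge0// sqr_ge0.
  have h1 : `|f x - f y| <= 2 * M.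
    rewrite (le_trans (ler_normB _ _))// mulr2n mulrDl mul1r lerD//; exact: HM.
  apply: (le_trans h1); rewrite -[leLHS]add0r lerD// ?(ltW e2)//.
  rewrite /C mulrAC ler_pdivlMr ?exprn_gt0// ler_wpM2l ?mulr_ge0//.
  by rewrite -(real_normK (num_real (cc x - cc y))) lerXn2r ?nnegrE ?(ltW m0)// Hm.
have [N N0 HN] : exists2 N, (0 < N)%N & C / N%:R <= e / 2.
  exists (Num.truncn (C / (e / 2))).+1 => //.
  rewrite ler_pdivrMr ?ltr0n// mulrC -ler_pdivrMr//.
  by rewrite ltW// truncnS_gt.
have NR : 0 < N%:R :> R by rewrite ltr0n.
(* The node [xk k] has [cc (xk k) = k / N], so [f (xk k)] samples [f] as a function of [cc]. *)
have xk k : exists x, (k <= N)%N -> 0 <= x <= 1 /\ cc x = k%:R / N%:R.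
  have [kN|] := boolP (k <= N)%N; last by exists 0.
  have /cc_surj[x xI xE] : 0 <= (k%:R / N%:R : R) <= 1.
    by rewrite divr_ge0//= ler_pdivrMr// mul1r ler_nat.
  by exists x.
have {xk} /choice[xk Hxk] : forall k : nat, exists x, (k <= N)%N -> 0 <= x <= 1 /\ cc
  x = k%:R / N%:R by exact: xk.
exists (fun x => bern (cc x) N (f \o xk)); first exact: spn_bern.
move=> x xI; rewrite distrC [e]splitr.
apply: (le_trans (bern_approx (e := e / 2) (cc_itv x) N0 C0 _)); last by rewrite lerD2l.
move=> k kN; have [xkI xkE] := Hxk k kN.
by rewrite /= -xkE; exact: modu.
Qed.

End UniformApproximation.

(** * Density in L^2 and indefinite integrals *)

Section SquareNorm.
Context {R : realType}.
Implicit Types (f g h : R -> R) (c M : R).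
Local Notation mu := (@lebesgue_measure R).

Definition nrm f : R := Num.sqrt (ip f f).

Lemma nrm_ge0 f : 0 <= nrm f. Proof. exact: sqrtr_ge0. Qed.

Lemma nrm_sqr f : nrm f ^+ 2 = ip f f.
Proof. by rewrite sqr_sqrtr ?ip_ge0. Qed.

Lemma ip_le_nrm f g : realL2 f -> realL2 g -> `|ip f g| <= nrm f * nrm g.
Proof.
move=> Lf Lg; rewrite -ler_sqr ?nnegrE ?mulr_ge0 ?nrm_ge0//.
by rewrite real_normK ?num_real// exprMn !nrm_sqr cauchy_schwarz.
Qed.

Lemma nrm_le_sup f M : realL2 f -> 0 <= M -> (forall x : R, 0 < x < 1 -> `|f x| <= M) ->
  nrm f <= M.
Proof.
move=> Lf M0 fM; rewrite -ler_sqr ?nnegrE ?nrm_ge0// nrm_sqr -[leRHS]rint_cst.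
apply: le_rint => [||x xI]; first exact: ip_intble.
  by apply: intbleL2; exact: realL2_cst.
by rewrite /= -expr2 -[leLHS]real_normK ?num_real// ler_sqr ?nnegrE ?fM.
Qed.

Lemma nrmM_le_sup f g M : realL2 f -> realL2 g -> realL2 (f \* g) -> 0 <= M ->
  (forall x : R, 0 < x < 1 -> `|f x| <= M) -> nrm (f \* g) <= M * nrm g.
Proof.
move=> Lf Lg Lfg M0 fM.
rewrite -ler_sqr ?nnegrE ?mulr_ge0 ?nrm_ge0// exprMn !nrm_sqr.
rewrite /ip -rintZ; last exact: ip_intble.
apply: le_rint => [||x xI]; [exact: ip_intble|apply: intbleZ; exact: ip_intble|].
rewrite scalefE /= mulrACA -!expr2 ler_wpM2r ?sqr_ge0//.
by rewrite -[leLHS]real_normK ?num_real// ler_sqr ?nnegrE ?fM.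
Qed.

Lemma nrmD f g : realL2 f -> realL2 g -> nrm (f + g) <= nrm f + nrm g.
Proof.
move=> Lf Lg; rewrite -ler_sqr ?nnegrE ?addr_ge0 ?nrm_ge0// nrm_sqr.
rewrite ipDl ?ipDr//; last exact: realL2D.
rewrite (ipC g f) sqrrD !nrm_sqr.
have := ip_le_nrm Lf Lg; have := ler_norm (ip f g); lra.
Qed.

Lemma norm_rint_le f : realL2 f -> `|rint f| <= nrm f.
Proof.
move=> Lf; have -> : rint f = ip f (fun=> 1).
  by congr rint; apply/funext => x /=; rewrite mulr1.
rewrite (le_trans (ip_le_nrm Lf (realL2_cst 1)))// -[leRHS]mulr1 ler_wpM2l ?nrm_ge0//.
by apply: nrm_le_sup => // [|x _]; [exact: realL2_cst|rewrite normr1].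
Qed.

(** The signed square root is Hoelder continuous of exponent 1/2; integrated, this bounds an L^2
    distance by the L^1 distance of the signed squares. *)
Lemma sqrB_le_signed_sqrB (a b : R) :
  (a - b) ^+ 2 <= 2 * `| a * `|a| - b * `|b| |.
Proof.
case: (ger0P a) => a0; case: (ger0P b) => b0.
- have [ab|ab] := leP b a.
    by rewrite ger0_norm ?subr_ge0; nra.
  by rewrite ler0_norm ?subr_le0; nra.
- have ab : 0 <= a * a - b * - b by nra.
  by rewrite ger0_norm// expr2; have := sqr_ge0 (a + b); rewrite expr2; nra.
- have ab : a * - a - b * b <= 0 by nra.
  by rewrite ler0_norm// expr2; have := sqr_ge0 (a + b); rewrite expr2; nra.
- have [ab|ab] := leP b a.
    by rewrite ger0_norm ?subr_ge0; nra.
  by rewrite ler0_norm ?subr_le0; nra.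
Qed.

(** The inverse of [a |-> a |a|]; since [Num.sqrt] is 0 on negative numbers, at most one of the two
    terms is nonzero. *)
Definition ssqrt (x : R) : R := Num.sqrt x - Num.sqrt (- x).

Lemma ssqrtK (x : R) : ssqrt x * `|ssqrt x| = x.
Proof.
rewrite /ssqrt; have [x0|x0] := leP 0 x.
  rewrite (@ler0_sqrtr _ (- x)) ?oppr_le0// subr0 ger0_norm ?sqrtr_ge0//.
  by rewrite -expr2 sqr_sqrtr.
rewrite (@ler0_sqrtr _ x) ?ltW// sub0r normrN ger0_norm ?sqrtr_ge0//.
by rewrite mulNr -expr2 sqr_sqrtr ?opprK// oppr_ge0 ltW.
Qed.

Lemma continuous_ssqrt : continuous ssqrt.
Proof.
move=> x; apply: cvgB; first exact: sqrt_continuous.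
by apply: continuous_comp; [exact: opp_continuous|exact: sqrt_continuous].
Qed.

(* Approximate f |f| in L^1 and take the signed square root. *)
Lemma continuous_dense f (e : R) : realL2 f -> 0 < e ->
  exists2 g, continuous g & ip (f - g) (f - g) <= e.
Proof.
move=> Lf e0; have e2 : 0 < e / 2 by rewrite divr_gt0.
set F := fun x => f x * `|f x|.
have mF : measurable_fun I01 F.
  apply: measurable_funM; first exact: realL2_meas.
  by apply: measurableT_comp => //; exact: realL2_meas.
have IF : intble F.
  apply: (le_intble mF (ip_intble Lf Lf)) => x _.
  by rewrite /F /= normrM normr_id -normrM ger0_norm// -expr2 sqr_ge0.
have muI : (mu I01 < +oo)%E.
  by rewrite [X in (X < _)%E](lebesgue_measure_itv `]0, 1[)/= lte_fin ltr01 ltry.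
have [g_ [cg Ig cvg]] := approximation_continuous_integrable measurable_I01 muI IF.
have [N HN] : exists N, rint (fun x => `|F x - g_ N x|) <= e / 2.
  have := cvg; move/fine_cvgP => [_ /cvgrPdist_lt/(_ _ e2)[N _ HN]].
  exists N; have := HN N (leqnn N) => /=; rewrite sub0r normrN => /ltW.
  by apply: le_trans; exact: ler_norm.
exists (ssqrt \o g_ N).
  by move=> x; apply: continuous_comp; [exact: cg|exact: continuous_ssqrt].
have ID : intble (fun x => `|F x - g_ N x|).
  exact: (integrable_abse (integrableB measurable_I01 IF (Ig N))).
have mg : measurable_fun I01 (ssqrt \o g_ N).
  apply: measurable_funTS; apply: continuous_measurable_fun => x.
  by apply: continuous_comp; [exact: cg|exact: continuous_ssqrt].
have key x : ((f x - ssqrt (g_ N x)) * (f x - ssqrt (g_ N x))) <= 2 * `|F x - g_ N x|.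
  by rewrite -expr2 -{2}(ssqrtK (g_ N x)) sqrB_le_signed_sqrB.
have -> : e = 2 * (e / 2) by field.
apply: (@le_trans _ _ (2 * rint (fun x => `|F x - g_ N x|))); last first.
  by rewrite ler_wpM2l.
rewrite -rintZ//; apply: le_rint => [||x _]; last exact: key.
  apply: (@le_intble _ _ (2 *: (fun x => `|F x - g_ N x|))) => [||x _].
  - by apply: measurable_funM; apply: measurable_funB => //; exact: realL2_meas.
  - exact: intbleZ.
  - by rewrite /= ger0_norm -?expr2 ?sqr_ge0// expr2; exact: key.
exact: intbleZ.
Qed.

Lemma continuous_cosm m : continuous (@cosm R m).
Proof.
move=> x; apply: continuous_comp; last exact: continuous_cos.
by apply: mulrl_continuous.
Qed.

Lemma cont01_spn (phi : nat -> R -> R) f : (forall k, cont01 (phi k)) ->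
  spn phi f -> cont01 f.
Proof. by move=> cphi [N [t ->]]; apply: cont01_sum => i; exact: cont01Z. Qed.

Lemma cos_dense_L2 f (e : R) : realL2 f -> 0 < e ->
  exists2 T, spn cosm T & nrm (f - T) <= e.
Proof.
move=> Lf e0; have e2 : 0 < e / 2 by rewrite divr_gt0.
have [g cg Hg] := continuous_dense Lf (exprn_gt0 2 e2).
have c01g := continuous_cont01 cg; have Lg := cont01_realL2 c01g.
have [T sT HT] := cos_dense_unif c01g e2.
have cT : cont01 T by apply: cont01_spn sT => k; apply: continuous_cont01;
  exact: continuous_cosm.
have LT := cont01_realL2 cT.
exists T => //; rewrite (_ : f - T = (f - g) + (g - T)); last first.
  by apply/funext => x; rewrite !(addfE, oppfE); ring.
set u := f - g; set v := g - T.
have Lu : realL2 u by exact: realL2B.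
have Lv : realL2 v by exact: realL2B.
have nu : nrm u <= e / 2.
  by rewrite -ler_sqr ?nnegrE ?nrm_ge0 ?(ltW e2)// nrm_sqr.
have nv : nrm v <= e / 2.
  by apply: nrm_le_sup => //; [exact: ltW|move=> x /andP[x0 x1]; apply: HT; rewrite !ltW].
by rewrite [e]splitr (le_trans (nrmD Lu Lv))// lerD.
Qed.

End SquareNorm.

(** * Differentiable functions and indefinite integrals on the unit interval *)

Section FundamentalTheorem.
Context {R : realType}.
Implicit Types (f g h : R -> R) (c M : R).
Local Notation mu := (@lebesgue_measure R).

Definition C1 f f' := (forall x : R, is_derive x 1 f (f' x)) /\ continuous f'.

Lemma C1_continuous f f' : C1 f f' -> continuous f.
Proof.
move=> [df _] x; apply/differentiable_continuous; rewrite -derivable1_diffP.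
by have [] := df x.
Qed.

Lemma C1D f f' g g' : C1 f f' -> C1 g g' -> C1 (f + g) (f' + g').
Proof.
move=> [df cf] [dg cg]; split=> x; first exact: is_deriveD.
exact: (cvgD (cf x) (cg x)).
Qed.

Lemma C1Z c f f' : C1 f f' -> C1 (c *: f) (c *: f').
Proof.
move=> [df cf]; split=> x; first exact: is_deriveZ.
exact: (cvgM (cvg_cst c) (cf x)).
Qed.

Lemma C1M f f' g g' : C1 f f' -> C1 g g' -> C1 (f \* g) (f \* g' + f' \* g).
Proof.
move=> f1 g1; have cf := C1_continuous f1; have cg := C1_continuous g1.
case: f1 g1 => [df cf'] [dg cg']; split=> x.
  have := is_deriveM (df x) (dg x); rewrite /GRing.scale/=.
  by rewrite addfE /= (mulrC (f' x)).
exact: (cvgD (cvgM (cf x) (cg' x)) (cvgM (cf' x) (cg x))).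
Qed.

Lemma integrable_itv_cont f a b : continuous f ->
  mu.-integrable `[a, b] (EFin \o f).
Proof.
move=> cf; apply: continuous_compact_integrable; first exact: segment_compact.
exact: continuous_subspaceT.
Qed.

Lemma Rintegral_itv_oo_cc f a b : mu.-integrable `[a, b] (EFin \o f) ->
  \int[mu]_(x in `]a, b[) f x = \int[mu]_(x in `[a, b]) f x.
Proof.
move=> If; rewrite Rintegral_itv_obnd_cbnd; last first.
  by apply: (integrableS _ _ _ If) => //; exact: subset_itv_oo_cc.
rewrite Rintegral_itv_bndo_bndc//.
by apply: (integrableS _ _ _ If) => //; exact: subset_itv_co_cc.
Qed.

Lemma Rintegral_C1 f f' x : C1 f f' -> 0 <= x ->
  \int[mu]_(t in `]0, x[) f' t = f x - f 0.
Proof.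
move=> C; have cf := C1_continuous C; case: C => df cf'.
rewrite le_eqVlt => /predU1P[<-|x0].
  by rewrite set_itvoo0 Rintegral_set0 subrr.
rewrite Rintegral_itv_oo_cc; last exact: integrable_itv_cont.
rewrite /Rintegral (@continuous_FTC2 _ f' f)//.
- exact: continuous_subspaceT.
- split; first by move=> t _; have [] := df t.
  + by apply: cvg_at_right_filter; exact: cf.
  + by apply: cvg_at_left_filter; exact: cf.
- by move=> t _; rewrite derive1E; have dft := df t; exact: derive_val.
Qed.

Lemma rint_C1 f f' : C1 f f' -> rint f' = f 1 - f 0.
Proof. by move=> C; exact: Rintegral_C1. Qed.

(** The real counterpart of the primitive conditions in the record [H2]. *)
Definition prim F f : Prop :=
  forall x : R, 0 <= x <= 1 -> F x = F 0 + \int[mu]_(t in `]0, x[) f t.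

Lemma C1_prim f f' : C1 f f' -> prim f f'.
Proof. by move=> C x /andP[x0 _]; rewrite (Rintegral_C1 C)// addrC subrK. Qed.

Lemma Rintegral_sub_I01 f x : 0 <= x <= 1 ->
  \int[mu]_(t in `]0, x[) f t = rint (f \_ `]0, x[).
Proof.
move=> /andP[x0 x1]; rewrite /rint -Rintegral_mkcondr; congr (Rintegral _ _ _).
by rewrite setIidr//; apply: subset_itvl; rewrite bnd_simp.
Qed.

Lemma realL2_restrict f u v : realL2 f -> realL2 (f \_ `]u, v[).
Proof.
move=> Lf; rewrite (_ : _ \_ _ = (\1_`]u, v[ : R -> R) \* f).
  by apply: (@realL2M_bounded _ _ _ 1) => // y _; rewrite indicE; case: (_ \in _) => /=;
    rewrite ?normr1 ?normr0.
by apply/funext => y; rewrite patchE /= indicE; case: (_ \in _) => /=;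
  rewrite ?mul1r ?mul0r.
Qed.

Lemma primD F f G g : realL2 f -> realL2 g -> prim F f -> prim G g -> prim (F + G) (f
  + g).
Proof.
move=> Lf Lg PF PG x xI; rewrite !addfE (PF x xI) (PG x xI) !Rintegral_sub_I01//.
rewrite (_ : (f + g) \_ _ = f \_ `]0, x[ + g \_ `]0, x[).
  by rewrite rintD; [ring|apply: intbleL2; exact: realL2_restrict..].
by apply/funext => y; rewrite addfE !patchE; case: ifP => //; rewrite addr0.
Qed.

Lemma primZ F f c : realL2 f -> prim F f -> prim (c *: F) (c *: f).
Proof.
move=> Lf PF x xI; rewrite !scalefE (PF x xI) !Rintegral_sub_I01//.
rewrite (_ : (c *: f) \_ _ = c *: f \_ `]0, x[).
  by rewrite rintZ ?mulrDr//; apply: intbleL2; exact: realL2_restrict.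
by apply/funext => y; rewrite scalefE !patchE; case: ifP => //; rewrite mulr0.
Qed.

(** Cauchy-Schwarz on []0, x[]: L^2 control of a derivative gives uniform control of the
    function. *)
Lemma prim_dist F f x : realL2 f -> prim F f -> 0 <= x <= 1 ->
  `|F x - F 0| <= nrm f.
Proof.
move=> Lf PF xI; rewrite (PF x xI) addrAC subrr add0r Rintegral_sub_I01//.
apply: (le_trans (norm_rint_le (realL2_restrict 0 x Lf))).
rewrite ler_sqrt ?ip_ge0//; apply: le_rint => [||y _].
- by apply: ip_intble; exact: realL2_restrict.
- exact: ip_intble.
- rewrite /= patchE; case: ifP => // _.
  by rewrite mulr0 -expr2 sqr_ge0.
Qed.

Lemma prim_cont01 F f : realL2 f -> prim F f -> cont01 F.
Proof.
move=> Lf PF; set f0 := f \_ I01.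
have If : mu.-integrable `[0, 1] (EFin \o f0).
  apply: (@integrableS _ _ _ _ setT) => //.
  have [+ _] := integrable_restrict mu measurable_I01 measurableT (EFin \o f).
  by rewrite setTI restrict_EFin; apply; exact: intbleL2.
apply: (@eq_cont01 _ (cst (F 0) + parameterized_integral mu 0 ^~ f0)).
  move=> x xI; rewrite addfE (PF x xI) /parameterized_integral -Rintegral_itv_oo_cc//.
    congr (_ + _); apply: eq_Rintegral => t; rewrite inE/= in_itv/= => /andP[t0 tx].
    rewrite /f0 patchE mem_set// /I01/= in_itv/= t0/=.
    by case/andP: xI => _; exact: lt_le_trans.
  apply: (integrableS _ _ _ If) => //; apply: subset_itvl.
  by case/andP: xI; rewrite bnd_simp.
apply: cont01D; first exact: cont01_cst.
by apply: within_cont01; exact: parameterized_integral_continuous.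
Qed.

End FundamentalTheorem.

(** * Trigonometric systems *)

Section TrigonometricSystems.
Context {R : realType}.
Implicit Types (f g h F phi : R -> R) (a c M : R).
Local Notation mu := (@lebesgue_measure R).

Lemma eq0_small (E C : R) : (forall d, 0 < d -> `|E| <= d * C) -> E = 0.
Proof.
move=> H; apply/eqP; rewrite -normr_le0; apply/ler_addgt0Pl => e e0; rewrite addr0.
have C1 : 0 < `|C| + 1 by rewrite ltr_pwDr.
apply: (le_trans (H (e / (`|C| + 1)) _)); first by rewrite divr_gt0.
rewrite mulrAC ler_pdivrMr// ler_wpM2l ?ltW//.
by rewrite (le_lt_trans (ler_norm C))// ltrDl.
Qed.

Lemma clamp_ge1 (x : R) : 1 <= x -> clamp x = 1.
Proof. by rewrite /clamp => x1; case: (leP x 0) => ?; [lra|rewrite x1]. Qed.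

Definition sinx a (x : R) : R := sin (a * x).
Definition cosx a (x : R) : R := cos (a * x).

Lemma C1_sinx a : C1 (sinx a) (a *: cosx a).
Proof.
split=> x; last first.
  apply: cvgM; first exact: cvg_cst.
  apply: continuous_comp; last exact: continuous_cos.
  exact: mulrl_continuous.
have := @is_derive1_comp _ sin (fun y => a * y) x _ _ _ _.
have h : is_derive x 1 (fun y : R => a * y) a.
  by have := is_deriveZ a (is_derive_id x (1:R)); rewrite /GRing.scale/= mulr1.
by move=> /(_ (cos (a * x)) a (is_derive_sin _) h); rewrite mulrC.
Qed.

Lemma C1_cosx a : C1 (cosx a) (- a *: sinx a).
Proof.
split=> x; last first.
  apply: cvgM; first exact: cvg_cst.
  apply: continuous_comp; last exact: continuous_sin.
  exact: mulrl_continuous.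
have := @is_derive1_comp _ cos (fun y => a * y) x _ _ _ _.
have h : is_derive x 1 (fun y : R => a * y) a.
  by have := is_deriveZ a (is_derive_id x (1:R)); rewrite /GRing.scale/= mulr1.
move=> /(_ (- sin (a * x)) a (is_derive_cos _) h).
by rewrite (_ : (- a *: sinx a) x = - sin (a * x) * a)// scalefE /sinx; ring.
Qed.

Lemma continuous_sinx a : continuous (sinx a).
Proof. exact: C1_continuous (C1_sinx a). Qed.

Lemma continuous_cosx a : continuous (cosx a).
Proof. exact: C1_continuous (C1_cosx a). Qed.

Lemma realL2_sinx a : realL2 (sinx a).
Proof. by apply: cont01_realL2; apply: continuous_cont01; exact: continuous_sinx. Qed.

Lemma realL2_cosx a : realL2 (cosx a).
Proof. by apply: cont01_realL2; apply: continuous_cont01; exact: continuous_cosx. Qed.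

Lemma primB F f G g : realL2 f -> realL2 g -> prim F f -> prim G g -> prim (F - G) (f
  - g).
Proof.
move=> Lf Lg PF PG; rewrite -scaleN1r -[- g]scaleN1r.
by apply: primD => //; [exact: realL2Z|exact: primZ].
Qed.

Lemma spn_cosm_primitive f : spn cosm f -> exists2 G, C1 G f & G 0 = 0.
Proof.
elim/(@spn_ind R) => [|g h [G CG G0] [H CH H0]|c m].
- exists (fun=> 0) => //; split; first by move=> x; exact: is_derive_cst.
  exact: cst_continuous.
- by exists (G + H); [exact: C1D|rewrite addfE G0 H0 addr0].
- case: m => [|m].
    exists (c *: id); last by rewrite scalefE mulr0.
    rewrite (_ : cosm 0 = cst 1).
      by apply: C1Z; split; [move=> x; exact: is_derive_id|exact: cst_continuous].
    by apply/funext => x; rewrite /cosm mulr0 mul0r cos0.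
  set a : R := pi * m.+1%:R.
  have a0 : a != 0 by rewrite mulf_neq0 ?gt_eqF ?pi_gt0.
  exists ((c / a) *: sinx a); last by rewrite scalefE /sinx mulr0 sin0 mulr0.
  rewrite (_ : c *: cosm _ = (c / a) *: (a *: cosx a)).
    by apply: C1Z; exact: C1_sinx.
  by rewrite scalerA divfK.
Qed.

(* Both sides are continuous in f for the L^2 norm, so f may be taken to be a
   cosine polynomial. *)
Lemma integration_by_parts01 F f phi phi' : realL2 f -> prim F f -> C1 phi phi' ->
  ip F phi' = F 1 * phi 1 - F 0 * phi 0 - ip f phi.
Proof.
move=> Lf PF Cphi; have cphi := continuous_cont01 (C1_continuous Cphi).
have cphi' : cont01 phi' by apply: continuous_cont01; case: Cphi.
have Lphi := cont01_realL2 cphi; have Lphi' := cont01_realL2 cphi'.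
have LF := cont01_realL2 (prim_cont01 Lf PF).
apply/eqP; rewrite -subr_eq0; apply/eqP.
apply: (@eq0_small _ (nrm phi' + `|phi 1| + nrm phi)) => d d0.
have [T sT fT] := cos_dense_L2 Lf d0.
have [G CG G0] := spn_cosm_primitive sT.
(* The primitive of the approximant [T] that agrees with [F] at 0; by [prim_dist] it stays within
   [d] of [F] on [0, 1]. *)
have CH : C1 (cst (F 0) + G) T.
  rewrite -[T]add0r; apply: C1D => //; split; first by move=> x; exact: is_derive_cst.
  exact: cst_continuous.
have LT : realL2 T.
  by apply: cont01_realL2; apply: continuous_cont01; case: CG.
set H : R -> R := cst (F 0) + G in CH.
have LH : realL2 H.
  by apply: cont01_realL2; apply: continuous_cont01; exact: C1_continuous CH.
have PD := primB Lf LT PF (C1_prim CH).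
have LfT : realL2 (f - T) by exact: realL2B.
have DE x : (F - H) x = F x - H x by [].
have H0 : H 0 = F 0 by rewrite /H addfE G0 addr0.
have D0 : (F - H) 0 = 0 by rewrite DE H0 subrr.
have Dx x : 0 <= x <= 1 -> `|(F - H) x| <= d.
  by move=> xI; have := prim_dist LfT PD xI; rewrite D0 subr0 => /le_trans; apply.
have LD : realL2 (F - H) by exact: realL2B.
have nD : nrm (F - H) <= d.
  by apply: nrm_le_sup => //; [exact: ltW|move=> x /andP[x0 x1]; apply: Dx; rewrite !ltW].
have IH : ip H phi' + ip T phi = H 1 * phi 1 - H 0 * phi 0.
  rewrite -(rint_C1 (C1M CH Cphi)) rintD//; exact: ip_intble.
have -> : ip F phi' - (F 1 * phi 1 - F 0 * phi 0 - ip f phi) =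
    ip (F - H) phi' - (F - H) 1 * phi 1 + ip (f - T) phi.
  rewrite ipBl// ipBl//; rewrite DE.
  have -> : ip H phi' = H 1 * phi 1 - H 0 * phi 0 - ip T phi by rewrite -IH addrK.
  rewrite H0; ring.
rewrite !mulrDr (le_trans (ler_normD _ _))// lerD//.
  rewrite (le_trans (ler_normB _ _))// lerD//.
    by rewrite (le_trans (ip_le_nrm LD Lphi'))// ler_wpM2r ?nrm_ge0.
  by rewrite normrM ler_wpM2r ?normr_ge0// Dx// ler01 lexx.
by rewrite (le_trans (ip_le_nrm LfT Lphi))// ler_wpM2r ?nrm_ge0.
Qed.

Lemma sin_pin (m : nat) : sin (pi * m%:R) = 0 :> R.
Proof.
elim: m => [|m IH]; first by rewrite mulr0 sin0.
by rewrite -natr1 mulrDr mulr1 sinDpi IH oppr0.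
Qed.

Lemma rint_cosm m : rint (cosm m) = (m == 0%N)%:R :> R.
Proof.
case: m => [|m].
  rewrite (_ : cosm 0 = fun=> 1); first by rewrite rint_cst.
  by apply/funext => x; rewrite /cosm mulr0 mul0r cos0.
set a : R := pi * m.+1%:R.
have a0 : a != 0 by rewrite mulf_neq0 ?gt_eqF ?pi_gt0.
have Lc : realL2 (cosx a) by exact: realL2_cosx.
apply: (mulfI a0); rewrite mulr0 -rintZ; last exact: intbleL2.
by rewrite (rint_C1 (C1_sinx a)) /sinx mulr1 mulr0 sin0 subr0 sin_pin.
Qed.

(* The frequencies of both problems: pi k for j = false (Dirichlet) and
   pi (k + 1/2) for j = true (Dirichlet-Neumann). *)
Definition kap (j : bool) (k : nat) : R := pi * (k.*2 + j)%:R / 2.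

Definition sinj j k : R -> R := sinx (kap j k).
Definition cosj j k : R -> R := cosx (kap j k).

Lemma kap_ge0 j k : 0 <= kap j k.
Proof. by rewrite divr_ge0 ?mulr_ge0 ?pi_ge0. Qed.

Lemma kapD j k l : kap j k + kap j l = pi * (k + l + j)%:R.
Proof.
rewrite /kap -!muln2 !natrD !natrM; by field.
Qed.

Lemma kapB j k l : (l <= k)%N -> kap j k - kap j l = pi * (k - l)%:R.
Proof. by move=> lk; rewrite /kap -!muln2 natrB// !natrD !natrM; field. Qed.

Lemma rint_lin2 (f g : R -> R) a c : realL2 f -> realL2 g ->
  rint (a *: f + c *: g) = a * rint f + c * rint g.
Proof.
by move=> Lf Lg; rewrite rintD ?rintZ//; do ?apply: intbleZ; exact: intbleL2.
Qed.

(** Sums and differences of two frequencies of one family are integer multiples of pi, so the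
    product formula reduces everything to [rint_cosm]. The second term is 1 only for [k = l = 0] and
    [j = false], where the cosine is constant. *)
Lemma ip_cosj j k l :
  ip (cosj j k) (cosj j l) = ((k == l)%:R + (k + l + j == 0)%N%:R) / 2.
Proof.
wlog lk : k l / (l <= k)%N.
  move=> H; have [|/ltnW] := leqP l k; first exact: H.
  by move=> /H; rewrite ipC eq_sym (addnC l).
rewrite /ip (_ : _ \* _ = 2^-1 *: cosm (k - l) + 2^-1 *: cosm (k + l + j)).
  rewrite rint_lin2; [|exact: realL2_cosx..].
  rewrite !rint_cosm -mulrDr mulrC subn_eq0.
  by congr ((_%:R + _) / 2); congr nat_of_bool; rewrite eqn_leq lk andbT.
apply/funext => x; rewrite addfE !scalefE /cosm /cosj /cosx /= -kapD -(kapB j lk).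
by rewrite !mulrDl mulNr cosB cosD; field.
Qed.

Lemma ip_sinj j k l :
  ip (sinj j k) (sinj j l) = ((k == l)%:R - (k + l + j == 0)%N%:R) / 2.
Proof.
wlog lk : k l / (l <= k)%N.
  move=> H; have [|/ltnW] := leqP l k; first exact: H.
  by move=> /H; rewrite ipC eq_sym (addnC l).
rewrite /ip (_ : _ \* _ = 2^-1 *: cosm (k - l) + (- 2^-1) *: cosm (k + l + j)).
  rewrite rint_lin2; [|exact: realL2_cosx..].
  rewrite !rint_cosm mulNr -mulrBr mulrC subn_eq0.
  by congr ((_%:R - _) / 2); congr nat_of_bool; rewrite eqn_leq lk andbT.
apply/funext => x; rewrite addfE !scalefE /cosm /sinj /sinx /= -kapD -(kapB j lk).
by rewrite !mulrDl mulNr cosB cosD; field.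
Qed.

(** * Bessel's inequality and best approximation for an orthogonal system *)

Section Orthogonal.
Variable phi : nat -> R -> R.
Hypothesis L2phi : forall k, realL2 (phi k).
Hypothesis ortho : forall k l, k != l -> ip (phi k) (phi l) = 0.

Definition psum N (t : nat -> R) : R -> R := \sum_(k < N) t k *: phi k.

Lemma ip_sum_phi N (t : nat -> R) l : (l < N)%N ->
  ip (psum N t) (phi l) = t l * ip (phi l) (phi l).
Proof.
move=> lN; rewrite /psum ip_suml//; last by move=> k _; exact: realL2Z.
rewrite (bigD1 (Ordinal lN))//= ipZl// big1 ?addr0// => k kl.
by rewrite ipZl// ortho ?mulr0//; apply: contra kl => /eqP kl; apply/eqP/val_inj.
Qed.

Lemma ip_sum_sum N (t : nat -> R) f : realL2 f ->
  ip (psum N t) f = \sum_(k < N) t k * ip f (phi k).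
Proof.
move=> Lf; rewrite /psum ip_suml//; last by move=> k _; exact: realL2Z.
by apply: eq_bigr => k _; rewrite ipZl// ipC.
Qed.

Lemma realL2_sumphi N (t : nat -> R) : realL2 (psum N t).
Proof. by apply: realL2_sum => k _; exact: realL2Z. Qed.

(** The system is orthogonal with square norms at most 1, so [ip S S <= ip S f], and the claim
    follows from [ip (f - S) (f - S) >= 0]. *)
Lemma bessel f N : realL2 f -> (forall k, ip (phi k) (phi k) <= 1) ->
  \sum_(k < N) ip f (phi k) ^+ 2 <= ip f f.
Proof.
move=> Lf phi1; set S := psum N (fun k => ip f (phi k)).
have LS : realL2 S by exact: (realL2_sumphi N (fun k => ip f (phi k))).
have := ip_ge0 (f - S); rewrite ip_sqrB// (ipC f).
have -> : ip S f = \sum_(k < N) ip f (phi k) ^+ 2.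
  by rewrite (ip_sum_sum N (fun k => ip f (phi k)))//; apply: eq_bigr => k _;
    rewrite expr2.
have : ip S S <= \sum_(k < N) ip f (phi k) ^+ 2.
  rewrite {1}/S (ip_sum_sum N (fun k => ip f (phi k)))//; apply: ler_sum => k _.
  rewrite (ip_sum_phi (fun k => ip f (phi k)))// expr2 mulrA.
  by rewrite -[leRHS]mulr1 ler_wpM2l// -expr2 sqr_ge0.
lra.
Qed.

(** [f - S] is orthogonal to the span of the first [N] functions, which contains [T - S]; Pythagoras
    gives both claims. The coefficients are specified by a product, which avoids dividing by square
    norms. *)
Lemma best_approx f N (s t : nat -> R) : realL2 f ->
  (forall k, (k < N)%N -> s k * ip (phi k) (phi k) = ip f (phi k)) ->
  let S := psum N s in let T := psum N t in
  ip (f - S) (f - S) = ip f f - \sum_(k < N) s k * ip f (phi k) /\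
  ip (f - S) (f - S) <= ip (f - T) (f - T).
Proof.
move=> Lf Hs S T.
have LS : realL2 S by exact: realL2_sumphi.
have LT : realL2 T by exact: realL2_sumphi.
have LfS : realL2 (f - S) by exact: realL2B.
have orth l : (l < N)%N -> ip (f - S) (phi l) = 0.
  by move=> lN; rewrite ipBl// ip_sum_phi// Hs// subrr.
have orthS (u : nat -> R) : ip (f - S) (psum N u) = 0.
  rewrite ipC ip_sum_sum// big1// => k _.
  by rewrite orth// mulr0.
split.
  by rewrite ipBr// orthS subr0 ipBl// ip_sum_sum.
have E : f - T = (f - S) - (T - S) by apply/funext => x; rewrite !(addfE, oppfE); ring.
have LTS : realL2 (T - S) by exact: realL2B.
have h : ip (f - S) (T - S) = 0 by rewrite ipBr// !orthS subrr.
rewrite E (@ip_sqrB _ (f - S) (T - S))// h mulr0 subr0 lerDl.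
exact: ip_ge0.
Qed.

End Orthogonal.

Lemma cosj_ortho j k l : k != l -> ip (cosj j k) (cosj j l) = 0.
Proof.
move=> kl; rewrite ip_cosj (negbTE kl) add0r.
case: eqP => [|_]; last by rewrite mul0r.
by case: k kl => // kl; case: l kl.
Qed.

Lemma sinj_ortho j k l : k != l -> ip (sinj j k) (sinj j l) = 0.
Proof.
move=> kl; rewrite ip_sinj (negbTE kl) sub0r.
case: eqP => [|_]; last by rewrite oppr0 mul0r.
by case: k kl => // kl; case: l kl.
Qed.

Lemma cosj_le1 j k : ip (cosj j k) (cosj j k) <= 1.
Proof. by rewrite ip_cosj eqxx; case: eqP => _ /=; lra. Qed.

Lemma sinj_le1 j k : ip (sinj j k) (sinj j k) <= 1.
Proof. by rewrite ip_sinj eqxx; case: eqP => _ /=; lra. Qed.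

Lemma cosm_cosj k : cosm k = cosj false k.
Proof.
apply/funext => x; rewrite /cosm /cosj /cosx /kap addn0 -muln2 natrM.
by congr (cos (_ * x)); field.
Qed.

Lemma bessel_cosj j f N : realL2 f -> \sum_(k < N) ip f (cosj j k) ^+ 2 <= ip f f.
Proof.
move=> Lf; apply: (bessel _ _ _ Lf); [|exact: cosj_ortho|exact: cosj_le1].
by move=> k; exact: realL2_cosx.
Qed.

Lemma bessel_sinj j f N : realL2 f -> \sum_(k < N) ip f (sinj j k) ^+ 2 <= ip f f.
Proof.
move=> Lf; apply: (bessel _ _ _ Lf); [|exact: sinj_ortho|exact: sinj_le1].
by move=> k; exact: realL2_sinx.
Qed.

(* For j = true, extend f to [1, 2] by x |-> - f (2 - x) and rescale to [0, 1]:
   only the odd cosines survive. *)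
Lemma cosj_dense (j : bool) f (e : R) : cont01 f -> (j -> f 1 = 0) -> 0 < e ->
  exists2 T, spn (cosj j) T & forall x, 0 <= x <= 1 -> `|f x - T x| <= e.
Proof.
case: j => [cf /(_ isT) f1 e0|cf _ e0]; last first.
  have [T sT HT] := cos_dense_unif cf e0; exists T => //.
  by rewrite (_ : cosj false = cosm)//; apply/funext => k; rewrite cosm_cosj.
pose G (t : R) := f (clamp (2 * t)) - f (clamp (2 - 2 * t)).
have cG : cont01 G.
  apply: continuous_cont01 => t.
  have c1 : continuous (fun t : R => 2 * t) by exact: mulrl_continuous.
  have c2 : continuous (fun t : R => 2 - 2 * t).
    by move=> x; apply: cvgB; [exact: cvg_cst|exact: c1].
  exact: (cvgB (continuous_comp (c1 t) (cf (2 * t))) (continuous_comp (c2 t) (cf (2 -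
    2 * t)))).
have [T sT HT] := cos_dense_unif cG e0.
exists (fun x => (T (x / 2) - T (1 - x / 2)) / 2).
  elim/(@spn_ind R) : sT {HT} => [|g h Sg Sh|c m].
  - rewrite (_ : (fun=> _) = 0); first exact: spn0.
    by apply/funext => x; rewrite subrr mul0r.
  - rewrite (_ : (fun=> _) = (fun x => (g (x / 2) - g (1 - x / 2)) / 2) + (fun x =>
    (h (x / 2) - h (1 - x / 2)) / 2)); first exact: spnD.
    by apply/funext => x; rewrite !addfE; field.
  - have cos1 x : cosm m (1 - x / 2) = (-1) ^+ m * cosm m (x / 2) :> R.
      rewrite /cosm mulrBr mulr1 cosB sin_pin mul0r addr0; congr (_ * _).
      elim: (m) => [|k IH]; first by rewrite mulr0 cos0.
      by rewrite -natr1 mulrDr mulr1 cosDpi IH exprS mulN1r.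
    have [om|em] := boolP (odd m).
      rewrite (_ : (fun=> _) = c *: cosj true m./2); first by apply: spnZ; exact: spn_gen.
      apply/funext => x; rewrite !scalefE cos1 -signr_odd om expr1 mulN1r.
      rewrite /cosj /cosx /cosm /kap -(_ : m = (m./2).*2 + true)%N; last first.
        by rewrite -[in LHS](odd_double_half m) om addnC.
      rewrite (_ : pi * m%:R * (x / 2) = pi * m%:R / 2 * x); last by field.
      by field.
    rewrite (_ : (fun=> _) = 0); first exact: spn0.
    by apply/funext => x;
      rewrite !scalefE cos1 -signr_odd (negbTE em) expr0 mul1r subrr mul0r.
move=> x xI.
have Gx : G (x / 2) = f x.
  rewrite /G (_ : 2 * (x / 2) = x); last by field.
  by rewrite clamp_id// (_ : clamp (2 - x) = 1) ?f1 ?subr0// clamp_ge1//; lra.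
have Gx' : G (1 - x / 2) = - f x.
  rewrite /G (_ : 2 - 2 * (1 - x / 2) = x); last by field.
  rewrite (clamp_id xI) (_ : 2 * (1 - x / 2) = 2 - x); last by field.
  by rewrite (_ : clamp (2 - x) = 1) ?f1 ?sub0r// clamp_ge1//; lra.
have h1 := HT (x / 2); have h2 := HT (1 - x / 2).
rewrite Gx in h1; rewrite Gx' in h2.
have {}h1 := h1 ltac:(lra); have {}h2 := h2 ltac:(lra).
move: h1 h2; rewrite !ler_norml; lra.
Qed.

(** A uniform approximant with [N0] terms, padded by zeros, competes with every longer partial sum,
    and the latter is the best approximation. *)
Lemma cosj_series (j : bool) f (s : nat -> R) (e : R) : cont01 f -> (j -> f 1 = 0) ->
  (forall k, s k * ip (cosj j k) (cosj j k) = ip f (cosj j k)) -> 0 < e ->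
  exists N0, forall N, (N0 <= N)%N -> nrm (f - psum (cosj j) N s) <= e.
Proof.
move=> cf f1 Hs e0; have [T [N0 [t TE]] HT] := cosj_dense cf f1 e0.
have Lf := cont01_realL2 cf.
have Lc k : realL2 (cosj j k) by exact: realL2_cosx.
exists N0 => N N0N.
pose t' k := if (k < N0)%N then t k else 0.
have TE' : T = psum (cosj j) N t'.
  rewrite /psum TE (big_ord_widen N (fun k => t k *: cosj j k))// big_mkcond/=.
  by apply: eq_bigr => k _; rewrite /t'; case: ifP => // _; rewrite scale0r.
have LT : realL2 T by rewrite TE'; exact: realL2_sumphi.
have nT : nrm (f - T) <= e.
  apply: nrm_le_sup; [exact: realL2B|exact: ltW|].
  by move=> x /andP[x0 x1]; apply: HT; rewrite !ltW.
apply: le_trans nT; rewrite ler_sqrt ?ip_ge0// TE'.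
by have [] := best_approx Lc (@cosj_ortho j) t' Lf (fun k (_ : (k < N)%N) => Hs k).
Qed.

(** The induction runs on the sharper telescoping bound [2 - 1 / (N + 1)] for [N + 1] terms. *)
Lemma sum_inv_sqr N : \sum_(k < N) (k.+1%:R ^+ 2)^-1 <= 2 :> R.
Proof.
suff H : \sum_(k < N.+1) (k.+1%:R ^+ 2)^-1 <= 2 - N.+1%:R^-1 :> R.
  case: N H => [|N] H; first by rewrite big_ord0.
  rewrite (le_trans (_ : _ <= \sum_(k < N.+2) (k.+1%:R ^+ 2)^-1))//.
    by rewrite [leRHS]big_ord_recr/= lerDl invr_ge0 sqr_ge0.
  by rewrite (le_trans H)// gerBl invr_ge0.
elim: N => [|N IH]; first by rewrite big_ord_recr big_ord0/= add0r expr1n invr1; lra.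
rewrite big_ord_recr/= (le_trans (lerD IH (lexx _)))//.
have n0 : 0 < N.+1%:R :> R by rewrite ltr0n.
have -> : N.+2%:R = N.+1%:R + 1 :> R by rewrite -natr1.
move: (N.+1%:R : R) n0 => n n0.
rewrite -subr_ge0 (_ : _ - _ = (n * (n + 1) ^+ 2)^-1);
  first by rewrite invr_ge0 mulr_ge0 ?sqr_ge0// ltW.
by field; rewrite !lt0r_neq0//; lra.
Qed.

(** Density of cosine polynomials bounds [ip f f] by twice the sum of the squared cosine
    coefficients, up to [e]; by hypothesis and [sum_inv_sqr] this is at most [4 tau ^ 2] times
    [ip f f], a factor below 1. *)
Lemma parseval_perturbed f (tau : R) : realL2 f -> ip f (cosm 0) = 0 -> 0 <= tau ->
  tau ^+ 2 * 4 < 1 ->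
  (forall m, `|ip f (cosm m.+1)| <= tau / m.+1%:R * nrm f) -> ip f f = 0.
Proof.
move=> Lf f0 tau0 tau1 Hf.
have Lc k : realL2 (@cosm R k) by rewrite cosm_cosj; exact: realL2_cosx.
have oc : forall k l, k != l -> ip (@cosm R k) (cosm l) = 0.
  by move=> k l; rewrite !cosm_cosj; exact: cosj_ortho.
suff : ip f f <= tau ^+ 2 * 4 * ip f f.
  by have := ip_ge0 f; nra.
apply/ler_addgt0Pl => e e0.
have se0 : 0 < Num.sqrt e by rewrite sqrtr_gt0.
have [T [N [t TE]] HT] := cos_dense_L2 Lf se0.
(* The factor 2 inverts the square norm 1/2 of [cosm k] for [k >= 1]; the constant term vanishes by
   [f0]. *)
pose s k : R := if k is 0 then 0 else 2 * ip f (cosm k).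
have Hs k : (k < N)%N -> s k * ip (cosm k) (cosm k) = ip f (cosm k).
  move=> _; case: k => [|k]; first by rewrite /s mul0r f0.
  rewrite [X in _ * X](_ : _ = 2^-1) /s; first by field.
  by rewrite cosm_cosj ip_cosj eqxx /= addr0 mul1r.
have [E1 E2] := best_approx Lc oc t Lf Hs.
have fT2 : ip (f - T) (f - T) <= e.
  by rewrite -nrm_sqr -(sqr_sqrtr (ltW e0)) ler_sqr ?nnegrE ?nrm_ge0 ?sqrtr_ge0.
rewrite TE in fT2; have := le_trans E2 fT2; rewrite E1 lerBlDr => /le_trans; apply.
rewrite lerD2l; case: N {t TE HT Hs E1 E2 fT2} => [|N].
  by rewrite big_ord0 !mulr_ge0 ?sqr_ge0 ?ip_ge0.
rewrite big_ord_recl/= mul0r add0r.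
apply: (@le_trans _ _ (\sum_(k < N) (2 * tau ^+ 2 * ip f f) * (k.+1%:R ^+ 2)^-1)).
  apply: ler_sum => k _;
    rewrite /bump/= -mulrA -!expr2 -[X in _ <= X]mulrA -[X in _ <= X]mulrA ler_wpM2l//.
  rewrite -(real_normK (num_real (ip f _))).
  have -> : tau ^+ 2 * (ip f f * (k.+1%:R ^+ 2)^-1) = (tau / k.+1%:R * nrm f) ^+ 2.
    by rewrite !exprMn nrm_sqr exprVn mulrA mulrAC.
  by rewrite lerXn2r ?nnegrE ?mulr_ge0 ?invr_ge0 ?nrm_ge0// Hf.
rewrite -mulr_sumr; have := sum_inv_sqr N; have := ip_ge0 f; have := sqr_ge0 tau.
set S := \sum_(k < N) _; move=> t2 i0 S2.
have : 2 * tau ^+ 2 * ip f f * S <= 2 * tau ^+ 2 * ip f f * 2.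
  by rewrite ler_wpM2l// !mulr_ge0.
lra.
Qed.

End TrigonometricSystems.

(** * A priori estimates for the weak equation *)

Section WeakProblem.
Context {R : realType}.
Implicit Types (p q f g h y z : R -> R) (a c M : R) (j : bool).
Local Notation mu := (@lebesgue_measure R).

(* y is in the form domain of problem j; y1 and y2 are its derivatives. *)
Definition adm j y y1 y2 : Prop :=
  [/\ realL2 y2, prim y1 y2, prim y y1 &
      y 0 = 0 /\ (if j then y1 1 = 0 else y 1 = 0)].

Definition wform p q y y1 y2 z z1 z2 : R :=
  ip y2 z2 + ip (p \* y1) z1 + ip (q \* y) z.

(** Weak form of [(L (p, q) - lam) y = f] with real data; a nonzero solution for [f = 0] is an
    eigenfunction. *)
Definition weak_sol j p q lam f y y1 y2 : Prop :=
  adm j y y1 y2 /\ forall z z1 z2, adm j z z1 z2 ->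
    wform p q y y1 y2 z z1 z2 = ip f z + lam * ip y z.

Lemma cos_kap_true k : cos (kap true k) = 0 :> R.
Proof.
rewrite /kap (_ : pi * _ / 2 = pi * k%:R + pi / 2); last first.
  by rewrite addn1 -natr1 -muln2 natrM; field.
by rewrite cosDpihalf sin_pin oppr0.
Qed.

Lemma sin_kap_false k : sin (kap false k) = 0 :> R.
Proof.
rewrite /kap (_ : pi * _ / 2 = pi * k%:R) ?sin_pin//.
by rewrite addn0 -muln2 natrM; field.
Qed.

Lemma realL2_sinj j k : realL2 (sinj j k : R -> R).
Proof. exact: realL2_sinx. Qed.

Lemma realL2_cosj j k : realL2 (cosj j k : R -> R).
Proof. exact: realL2_cosx. Qed.

Lemma adm_sinj j k :
  adm j (sinj j k) (kap j k *: cosj j k) (- kap j k ^+ 2 *: sinj j k).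
Proof.
split; first by apply: realL2Z; exact: realL2_sinx.
- rewrite (_ : - kap j k ^+ 2 *: sinj j k = kap j k *: (- kap j k *: sinj j k)).
    by apply: C1_prim; apply: C1Z; exact: C1_cosx.
  by rewrite scalerA expr2 mulrN.
- by apply: C1_prim; exact: C1_sinx.
- split; first by rewrite /sinj /sinx mulr0 sin0.
  case: j; last by rewrite /sinj /sinx mulr1 sin_kap_false.
  by rewrite scalefE /cosj /cosx mulr1 cos_kap_true mulr0.
Qed.

Section Admissible.
Variables (j : bool) (y y1 y2 : R -> R).
Hypothesis A : adm j y y1 y2.

Lemma adm_cont1 : cont01 y1.
Proof. by case: A => L P _ _; exact: prim_cont01 P. Qed.

Lemma adm_cont : cont01 y.
Proof. by case: A => _ _ P _; apply: prim_cont01 P; apply: cont01_realL2;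
  exact: adm_cont1. Qed.

Lemma adm_L2 : realL2 y. Proof. exact: cont01_realL2 adm_cont. Qed.
Lemma adm_L2_1 : realL2 y1. Proof. exact: cont01_realL2 adm_cont1. Qed.
Lemma adm_L2_2 : realL2 y2. Proof. by case: A. Qed.

(** Integration by parts without boundary terms: [y] vanishes at 0, and at 1 either [y] or the
    cosine does, according to [j]. *)
Lemma adm_cos k : ip y1 (cosj j k) = kap j k * ip y (sinj j k).
Proof.
have [_ _ P [y0 yb]] := A.
have := integration_by_parts01 adm_L2_1 P (C1_cosx (kap j k)).
rewrite -/(cosj j k) -/(sinj j k) ipZr; [|exact: realL2_sinx|exact: adm_L2].
rewrite y0 mul0r (_ : y 1 * cosj j k 1 = 0) ?subrr ?sub0r; first by lra.
case: j yb => [_|->]; last by rewrite mul0r.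
by rewrite /cosj /cosx mulr1 cos_kap_true mulr0.
Qed.

(** The boundary terms vanish again: the sine is 0 at 0, and at 1 either [y1] or the sine is 0. *)
Lemma adm_sin k : ip y2 (sinj j k) = - kap j k ^+ 2 * ip y (sinj j k).
Proof.
have [L P _ [y0 yb]] := A.
have := integration_by_parts01 L P (C1_sinx (kap j k)).
rewrite -/(cosj j k) -/(sinj j k) ipZr; [|exact: realL2_cosx|exact: adm_L2_1].
rewrite adm_cos (_ : y1 1 * sinj j k 1 = 0).
  by rewrite /sinj {2}/sinx mulr0 sin0 mulr0 subrr sub0r => E; apply: oppr_inj;
    rewrite -E; ring.
case: j yb => [->|_]; first by rewrite mul0r.
by rewrite /sinj /sinx mulr1 sin_kap_false mulr0.
Qed.

Lemma adm_sup x : 0 <= x <= 1 -> `|y x| <= nrm y1.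
Proof.
have [_ _ P [y0 _]] := A => xI.
by have := prim_dist adm_L2_1 P xI; rewrite y0 subr0.
Qed.

End Admissible.

Lemma le_nrm_on_interval h (eta u v : R) : realL2 h -> 0 <= u -> u <= v -> v <= 1 ->
  0 <= eta ->
  (forall x, u < x < v -> eta <= `|h x|) -> eta ^+ 2 * (v - u) <= nrm h ^+ 2.
Proof.
move=> Lh u0 uv v1 eta0 H.
have sub : `]u, v[ `<=` I01.
  by apply: subset_itv; rewrite bnd_simp.
have -> : eta ^+ 2 * (v - u) = rint ((fun=> eta ^+ 2) \_ `]u, v[).
  rewrite /rint -Rintegral_mkcondr setIidr// Rintegral_cst//.
  rewrite [X in fine X](lebesgue_measure_itv `]u, v[)/=.
  case: ifPn => [_|]; first by rewrite -EFinB.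
  by rewrite lte_fin -leNgt => vu; rewrite /= (_ : v - u = 0) // ; lra.
rewrite nrm_sqr; apply: le_rint => [||x xI].
- by apply: intbleL2; apply: realL2_restrict; exact: realL2_cst.
- exact: ip_intble.
- rewrite patchE; case: ifPn => [|_]; last by rewrite /= -expr2 sqr_ge0.
  rewrite inE /= in_itv/= => xuv; rewrite -expr2 -(real_normK (num_real (h x))).
  by rewrite ler_sqr ?nnegrE ?H.
Qed.

(** If [|g x0| > B], then by continuity [|g|] exceeds [B] by a fixed amount on an interval near
    [x0], which bounds the norm of [g - S] from below for every admissible [S]. Pointwise bounds
    thus survive mere L^2 convergence. *)
Lemma sup_le_of_L2_approx g (B : R) : cont01 g ->
  (forall e : R, 0 < e -> exists S, [/\ realL2 S,
     forall x, 0 <= x <= 1 -> `|S x| <= B & nrm (g - S) <= e]) ->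
  forall x : R, 0 <= x <= 1 -> `|g x| <= B.
Proof.
move=> cg H x0 x0I; rewrite leNgt; apply/negP => gB.
pose eta : R := (`|g x0| - B) / 2.
have eta0 : 0 < eta by rewrite divr_gt0 ?subr_gt0.
have [d0 d00 Hd0] := cont01_unif cg eta0.
pose d : R := Num.min d0 2^-1.
have dp : 0 < d by rewrite lt_min d00 invr_gt0 ltr0n.
have dd0 : d <= d0 by rewrite ge_min lexx.
have d2 : d <= 2^-1 by rewrite ge_min lexx orbT.
have e0 : 0 < Num.sqrt (eta ^+ 2 * d / 2) by rewrite sqrtr_gt0 divr_gt0// mulr_gt0//
  exprn_gt0.
have [S [LS SB gS]] := H _ e0.
have LgS : realL2 (g - S) by apply: realL2B => //; exact: cont01_realL2.
(* The interval of length [d <= 1/2] lies on the side of [x0] on which it stays within [0, 1]. *)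
have [u [v [u0 vu v1 uvx]]] : exists u v : R, [/\ 0 <= u, v = u + d, v <= 1 &
    forall x, u < x < v -> `|x0 - x| < d].
  have [x2|x2] := leP x0 2^-1.
    exists x0, (x0 + d); split=> //; [lra|lra|].
    by move=> x xI; rewrite ltr_norml; lra.
  exists (x0 - d), x0; split=> //; [lra|lra|lra|].
  by move=> x xI; rewrite ltr_norml; lra.
have low x : u < x < v -> eta <= `|(g - S) x|.
  move=> xI; have x01 : 0 <= x <= 1 by lra.
  have := Hd0 x0 x x0I x01 (lt_le_trans (uvx x xI) dd0).
  have := SB x x01; rewrite addfE oppfE.
  have := ler_normB (g x0 - g x) (S x - g x).
  have := ler_normB (g x) (S x).
  have h1 : `|g x0| <= `|g x0 - g x| + (`|g x - S x| + `|S x|).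
    have {1}-> : g x0 = (g x0 - g x) + ((g x - S x) + S x) by ring.
    by rewrite (le_trans (ler_normD _ _))// lerD2l ler_normD.
  move: h1; rewrite /eta; lra.
have uv : u <= v by rewrite vu lerDl ltW.
have := le_nrm_on_interval LgS u0 uv v1 (ltW eta0) low.
have : nrm (g - S) ^+ 2 <= eta ^+ 2 * d / 2.
  rewrite -[leRHS]sqr_sqrtr; first by rewrite ler_sqr ?nnegrE ?nrm_ge0 ?sqrtr_ge0.
  by rewrite divr_ge0// mulr_ge0 ?sqr_ge0// ltW.
have : 0 < eta ^+ 2 * d by rewrite mulr_gt0 ?exprn_gt0.
by rewrite vu; lra.
Qed.

(** The indices below [n] and those above [n] each give a sum bounded by [sum_inv_sqr]. *)
Lemma sum_inv_sqr_shift n N :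
  \sum_(k < N | k != n :> nat) (`|k%:R - n%:R| ^+ 2)^-1 <= 4 :> R.
Proof.
pose w (k : nat) : R := (`|k%:R - n%:R| ^+ 2)^-1.
have w0 k : 0 <= w k by rewrite invr_ge0 sqr_ge0.
have h0 : \sum_(k < N | k != n :> nat) w k <= \sum_(k < n.+1 + N | k != n :> nat) w k.
  rewrite [leRHS](bigID (fun k : 'I_(n.+1 + N) => (k < N)%N))/= -[leLHS]addr0 lerD
    ?sumr_ge0//.
  rewrite (big_ord_widen_cond (n.+1 + N) (fun k => k != n) w) ?leq_addl//.
apply: (le_trans h0); rewrite big_split_ord/= big_mkcond/= big_ord_recr/= eqxx addr0.
have -> : 4 = 2 + 2 :> R by lra.
apply: lerD.
  apply: le_trans (sum_inv_sqr n); rewrite (reindex_inj rev_ord_inj)/=.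
  apply: ler_sum => i _; case: ifP => _; last by rewrite invr_ge0 sqr_ge0.
  rewrite /w natrB// distrC opprB addrC subrK ger0_norm//.
apply: le_trans (sum_inv_sqr N); rewrite big_mkcond/=; apply: ler_sum => i _.
case: ifP => _; last by rewrite invr_ge0 sqr_ge0.
by rewrite /w addSnnS natrD addrAC subrr add0r ger0_norm.
Qed.

(** * Fourier coefficients of a weak solution with perturbed constant coefficients *)

Section Apriori.
Variables (j : bool) (n : nat) (a1 a2 gam lam alpha D : R).
Variables (p q y y1 y2 : R -> R).
Let P : R -> R := p \- (fun=> a1).
Let Q : R -> R := q \- (fun=> a2).
Let K k := Num.max (kap j k) (kap j n) : R.
Let Lam k : R := kap j k ^+ 4 + a1 * kap j k ^+ 2 + a2.
Hypotheses (Lp : realL2 p) (Lq : realL2 q).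
Hypothesis sol : weak_sol j p q lam (alpha *: sinj j n) y y1 y2.
Hypotheses (gam0 : 0 < gam) (kn1 : 1 <= (kap j n : R)) (D0 : 0 < D).
Hypothesis gap : forall k : nat, k != n -> 0 < (kap j k : R) ->
  gam * `|k%:R - n%:R| * K k ^+ 3 <= `|Lam k - lam|.
Hypotheses (PD : nrm (P \* y1) <= D) (QD : nrm (Q \* y) <= D).

Let A : adm j y y1 y2. Proof. by case: sol. Qed.

(** The sines of positive frequency have square norm 1/2, whence the factor 2. *)
Definition fcoef k : R := 2 * ip y (sinj j k).
Let d k := ip (P \* y1) (cosj j k).
Let d' k := ip (Q \* y) (sinj j k).

Let LP : realL2 P. Proof. by apply: realL2B => //; exact: realL2_cst. Qed.
Let LQ : realL2 Q. Proof. by apply: realL2B => //; exact: realL2_cst. Qed.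
Let LPy : realL2 (P \* y1).
Proof.
rewrite (_ : P \* y1 = y1 \* P); first by apply: cont01_realL2M => //; exact: adm_cont1 A.
by apply/funext => x /=; rewrite mulrC.
Qed.
Let LQy : realL2 (Q \* y).
Proof.
rewrite (_ : Q \* y = y \* Q); first by apply: cont01_realL2M => //; exact: adm_cont A.
by apply/funext => x /=; rewrite mulrC.
Qed.

(** The equation is tested with the k-th sine after writing [p = a1 + P] and [q = a2 + Q]; the
    constant parts produce [Lam k] by [adm_sin] and [adm_cos]. *)
Lemma coef_eq k : (Lam k - lam) * fcoef k =
  alpha * (2 * ip (sinj j n) (sinj j k)) - 2 * (kap j k * d k + d' k).
Proof.
have [_ /(_ _ _ _ (adm_sinj j k))] := sol.
have Ls := realL2_sinj j k.
have Lc := realL2_cosj j k.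
have Lsn := realL2_sinj j n.
have Ly := adm_L2 A; have Ly1 := adm_L2_1 A; have Ly2 := adm_L2_2 A.
rewrite /wform (_ : p \* y1 = a1 *: y1 + P \* y1); last first.
  by apply/funext => x; rewrite addfE scalefE /P /=; ring.
rewrite (_ : q \* y = a2 *: y + Q \* y); last first.
  by apply/funext => x; rewrite addfE scalefE /Q /=; ring.
have Lay1 := realL2Z a1 Ly1; have Lay := realL2Z a2 Ly; have Lkc := realL2Z (kap j k) Lc.
rewrite (ipDl Lay1)// (ipDl Lay)// (ipZl alpha Lsn Ls) (ipZl a1 Ly1 Lkc).
rewrite (ipZl a2 Ly Ls) (ipZr _ Ls Ly2) (ipZr _ Lc Ly1) (ipZr _ Lc LPy).
rewrite (adm_sin A) (adm_cos A) /fcoef /d /d' /Lam => E.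
by apply/eqP; rewrite -subr_eq0; apply/eqP; move: E; set X := ip y _; lra.
Qed.

Let d_le k : `|d k| <= D.
Proof.
have Lc := realL2_cosj j k.
apply: (le_trans (ip_le_nrm LPy Lc)); rewrite -[leRHS]mulr1 ler_pM ?nrm_ge0//.
by rewrite -(ler_sqr _ _) ?nnegrE ?nrm_ge0// nrm_sqr expr1n cosj_le1.
Qed.

Let d'_le k : `|d' k| <= D.
Proof.
have Ls := realL2_sinj j k.
apply: (le_trans (ip_le_nrm LQy Ls)); rewrite -[leRHS]mulr1 ler_pM ?nrm_ge0//.
by rewrite -(ler_sqr _ _) ?nnegrE ?nrm_ge0// nrm_sqr expr1n sinj_le1.
Qed.

Lemma main_coef : `|(Lam n - lam) * fcoef n - alpha| <= 4 * kap j n * D.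
Proof.
rewrite coef_eq ip_sinj eqxx (_ : (n + n + j == 0)%N = false); last first.
  apply/negbTE; apply: contraL kn1 => /eqP; case: n => [|//]; case: j => //= _.
  by rewrite -ltNge /kap mulr0 mul0r ltr01.
rewrite subr0 (_ : _ - alpha = - (2 * (kap j n * d n + d' n))); last by rewrite /=; field.
rewrite normrN normrM ger0_norm// -mulrA -[4]/(2 * 2)%:R natrM -mulrA ler_wpM2l//.
rewrite (le_trans (ler_normD _ _))// normrM (ger0_norm (kap_ge0 _ _)).
rewrite mulr2n mulrDl mul1r lerD// ?ler_wpM2l ?kap_ge0 ?d_le//.
by rewrite (le_trans (d'_le n))// ler_peMl// ltW.
Qed.

(** In [coef_eq] the right side is at most [2 K (|d| + |d'|)], while the gap supplies
    [gam |k - n| K ^ 3]. One spare factor [K] is lowered to [kap j n]; the one kept on the left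
    dominates both [kap j k] and [kap j n]. *)
Let coef_le k : k != n -> K k * `|fcoef k| <=
  2 / (gam * kap j n) * ((`|d k| + `|d' k|) * `|k%:R - n%:R|^-1).
Proof.
move=> kn; have kn0 : 0 < kap j n := lt_le_trans ltr01 kn1.
(* Frequency 0 is outside the gap hypothesis, but its sine is the zero function. *)
have [k0|k0] := leP (kap j k : R) 0.
  have {}k0 : kap j k = 0 :> R by apply/eqP; rewrite eq_le k0 kap_ge0.
  rewrite /fcoef (_ : sinj j k = 0).
    rewrite ipC ip0l mulr0 normr0 mulr0 !mulr_ge0 ?addr_ge0 ?invr_ge0 ?mulr_ge0
      ?kap_ge0 ?pi_ge0//.
    exact: ltW.
  by apply/funext => x; rewrite /sinj /sinx k0 mul0r sin0.
have w0 : 0 < `|k%:R - n%:R| :> R by rewrite normr_gt0 subr_eq0 eqr_nat.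
have := gap kn k0; have := coef_eq k; rewrite sinj_ortho 1?eq_sym// !mulr0 sub0r.
move=> /(congr1 (fun t => `|t|));
  rewrite normrM normrN [RHS]normrM (ger0_norm (_ : 0 <= 2)) //.
have Kn : kap j n <= K k by rewrite le_max lexx orbT.
have Kk : kap j k <= K k by rewrite le_max lexx.
move: (K k) Kn Kk (Lam k - lam) => Kk' Kn Kk L E G.
have h : `|kap j k * d k + d' k| <= Kk' * (`|d k| + `|d' k|).
  rewrite (le_trans (ler_normD _ _))// normrM ger0_norm ?kap_ge0// mulrDr lerD//.
    by rewrite ler_wpM2r.
  by rewrite ler_peMl//; exact: le_trans Kn.
have b0 := normr_ge0 (fcoef k).
have Kp : 0 < Kk' by exact: lt_le_trans Kn.
rewrite [X in _ <= X](_ : _ = 2 * (`|d k| + `|d' k|) / (gam * `|k%:R - n%:R| * kap j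
  n)); last first.
  by field; rewrite !lt0r_neq0.
rewrite ler_pdivlMr; last by rewrite mulr_gt0// mulr_gt0.
have h2 : gam * `|k%:R - n%:R| * Kk' ^+ 3 * `|fcoef k| <= 2 * (Kk' * (`|d k| + `|d' k|)).
  apply: (@le_trans _ _ (`|L| * `|fcoef k|)); first by rewrite ler_wpM2r.
  by rewrite E ler_wpM2l.
have h3 : gam * `|k%:R - n%:R| * Kk' ^+ 2 * `|fcoef k| <= 2 * (`|d k| + `|d' k|).
  rewrite -(ler_pM2l Kp);
    apply: le_trans (_ : _ <= 2 * (Kk' * (`|d k| + `|d' k|))) _; last by lra.
  by apply: le_trans h2; rewrite le_eqVlt; apply/orP; left; apply/eqP; ring.
apply: le_trans h3; rewrite expr2.
have : 0 <= gam * `|k%:R - n%:R| * Kk' * `|fcoef k| by rewrite !mulr_ge0// ltW.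
move=> t0; rewrite [leLHS](_ : _ = gam * `|k%:R - n%:R| * Kk' * `|fcoef k| * kap j
  n); last by ring.
rewrite [leRHS](_ : _ = gam * `|k%:R - n%:R| * Kk' * `|fcoef k| * Kk'); last by ring.
by rewrite ler_wpM2l.
Qed.

(** A weighted Cauchy-Schwarz inequality: Bessel bounds the squares of [d] and of [d'] by [D ^ 2]
    each, and the inverse squares of [k - n] sum to at most 4, for a total of [4 D]. *)
Lemma tail_le N : \sum_(k < N | k != n :> nat) K k * `|fcoef k| <= 8 * D / (gam * kap
  j n).
Proof.
have kn0 : 0 < kap j n := lt_le_trans ltr01 kn1.
apply: (@le_trans _ _ (\sum_(k < N | k != n :> nat)
    2 / (gam * kap j n) * ((`|d k| + `|d' k|) * `|k%:R - n%:R|^-1))).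
  by apply: ler_sum => k; exact: coef_le.
rewrite -mulr_sumr (_ : 8 * D / _ = 2 / (gam * kap j n) * (4 * D)); last first.
  by field; rewrite !lt0r_neq0.
have c0 : 0 <= 2 / (gam * kap j n) by rewrite divr_ge0// mulr_ge0// ltW.
rewrite ler_wpM2l//.
apply: (@le_trans _ _ (\sum_(k < N | k != n :> nat)
    (D^-1 * (d k ^+ 2 + d' k ^+ 2) + D / 2 * (`|k%:R - n%:R| ^+ 2)^-1))).
  apply: ler_sum => k _; rewrite -exprVn; move: (`|_|^-1) => w.
  rewrite -(real_normK (num_real (d k))) -(real_normK (num_real (d' k))).
  move: (`|d k|) (`|d' k|) => s t.
  (* The difference of the two sides is a sum of squares. *)
  rewrite -subr_ge0 (_ : _ - _ = (2 * D)^-1 * ((s - t) ^+ 2 + (s + t - D * w) ^+ 2)).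
    by rewrite mulr_ge0 ?addr_ge0 ?sqr_ge0// invr_ge0 mulr_ge0// ltW.
  by field; rewrite lt0r_neq0.
rewrite big_split/= -!mulr_sumr big_split/=.
have s1 : \sum_(k < N | k != n :> nat) d k ^+ 2 <= D ^+ 2.
  apply: (@le_trans _ _ (\sum_(k < N) d k ^+ 2)).
    by rewrite [leRHS](bigID (fun k : 'I_N => k != n :> nat))/= lerDl sumr_ge0// => k
      _; exact: sqr_ge0.
  apply: (le_trans (bessel_cosj j N LPy)).
  by rewrite -nrm_sqr ler_sqr ?nnegrE ?nrm_ge0// ltW.
have s2 : \sum_(k < N | k != n :> nat) d' k ^+ 2 <= D ^+ 2.
  apply: (@le_trans _ _ (\sum_(k < N) d' k ^+ 2)).
    by rewrite [leRHS](bigID (fun k : 'I_N => k != n :> nat))/= lerDl sumr_ge0// => k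
      _; exact: sqr_ge0.
  apply: (le_trans (bessel_sinj j N LQy)).
  by rewrite -nrm_sqr ler_sqr ?nnegrE ?nrm_ge0// ltW.
have s3 := sum_inv_sqr_shift n N.
have -> : 4 * D = D^-1 * (D ^+ 2 + D ^+ 2) + D / 2 * 4.
  by field; rewrite lt0r_neq0.
rewrite lerD// ler_wpM2l ?invr_ge0 ?divr_ge0 ?(ltW D0)//.
by rewrite lerD.
Qed.

Let s k := kap j k * fcoef k.
Let B : R := 8 * D / (gam * kap j n).

(** The only cosine whose square norm is not 1/2 is the constant one, where both sides vanish with
    the frequency. *)
Let Hs k : s k * ip (cosj j k) (cosj j k) = ip y1 (cosj j k).
Proof.
rewrite (adm_cos A) /s /fcoef ip_cosj eqxx.
case: eqP => [|_]; last by rewrite /= addr0; field.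
by case: k => // /eqP; rewrite /kap; case: j => //; rewrite mulr0 mul0r !mul0r.
Qed.

Let split_sum (F : nat -> R -> R) N x : (n < N)%N ->
  (\sum_(k < N) F k) x = F n x + \sum_(k < N | k != n :> nat) F k x.
Proof.
move=> nN; by rewrite (bigD1 (Ordinal nN))//= addfE fct_sumE; congr (_ + _).
Qed.

Let series e : 0 < e -> exists2 N, (n < N)%N & nrm (y1 - psum (cosj j) N s) <= e.
Proof.
move=> e0; have y1b : j -> y1 1 = 0 by case: A => _ _ _ [_ +]; case: j.
have [N0 HN] := cosj_series (adm_cont1 A) y1b Hs e0.
exists (maxn N0 n.+1); first by rewrite leq_maxr.
by apply: HN; rewrite leq_maxl.
Qed.

(** The partial cosine sums of [y1] without the n-th term are bounded by [tail_le] and converge in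
    L^2, so [sup_le_of_L2_approx] applies. *)
Lemma apriori_deriv x : 0 <= x <= 1 ->
  `|y1 x - kap j n * fcoef n * cos (kap j n * x)| <= B.
Proof.
move: x; pose g : R -> R := y1 - s n *: cosj j n.
have Lc := realL2_cosj j.
have cg : cont01 g.
  apply: cont01B; first exact: adm_cont1 A.
  by apply: cont01Z; apply: continuous_cont01; exact: continuous_cosx.
suff H : forall x, 0 <= x <= 1 -> `|g x| <= B by move=> x; exact: H.
apply: (sup_le_of_L2_approx cg) => e /series[N nN HN].
exists (\sum_(k < N | k != n :> nat) s k *: cosj j k); split.
- by apply: realL2_sum => k _; exact: realL2Z.
- move=> x _; apply: le_trans (tail_le N); rewrite fct_sumE.
  apply: (le_trans (ler_norm_sum _ _ _)); apply: ler_sum => k _.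
  have -> : (s k *: cosj j k) x = kap j k * (fcoef k * cosj j k x) by rewrite scalefE
    -mulrA.
  rewrite normrM (ger0_norm (kap_ge0 j k)) normrM ler_pM ?kap_ge0 ?mulr_ge0//.
    by rewrite le_max lexx.
  by rewrite ler_piMr// cos_max.
- rewrite (_ : g - _ = y1 - psum (cosj j) N s)//; apply/funext => x.
  rewrite /g /psum !(addfE, oppfE) (split_sum (fun k => s k *: cosj j k) x nN) fct_sumE.
  ring.
Qed.

(** The sine sum [Y] has the cosine sum as derivative, so [prim_dist] makes its convergence uniform.
    The factor [kap j n] is absorbed by [K k] in [tail_le]. *)
Lemma apriori_fun x : 0 <= x <= 1 ->
  kap j n * `|y x - fcoef n * sin (kap j n * x)| <= B.
Proof.
move=> xI; have kn0 : 0 < kap j n := lt_le_trans ltr01 kn1.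
apply/ler_addgt0Pl => e e0.
have [N nN HN] := series (divr_gt0 e0 kn0).
have Lc := realL2_cosj j.
have Lps : realL2 (psum (cosj j) N s) by exact: realL2_sumphi.
pose Y : R -> R := psum (sinj j) N fcoef.
have CY : C1 Y (psum (cosj j) N s).
  rewrite /Y /psum; elim: (N) => [|m IH].
    rewrite !big_ord0; split; last exact: cst_continuous.
    by move=> t; exact: is_derive_cst.
  rewrite !big_ord_recr/=; apply: C1D => //.
  rewrite (_ : s m *: cosj j m = fcoef m *: (kap j m *: cosj j m)).
    by apply: C1Z; exact: C1_sinx.
  by rewrite scalerA mulrC.
have [_ _ Py [y0 _]] := A.
have Y0 : Y 0 = 0.
  rewrite /Y /psum fct_sumE big1// => k _.
  by rewrite scalefE /sinj /sinx mulr0 sin0 mulr0.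
have := prim_dist (realL2B (adm_L2_1 A) Lps) (primB (adm_L2_1 A) Lps Py (C1_prim CY)) xI.
rewrite !(addfE, oppfE) y0 Y0 !subrr subr0 => yY.
have {}yY := le_trans yY HN.
rewrite /Y /psum (split_sum (fun k => fcoef k *: sinj j k) x nN) scalefE in yY.
set rest := \sum_(k < N | _) _ in yY.
have rB : kap j n * `|rest| <= B.
  apply: le_trans (tail_le N).
  apply: (@le_trans _ _ (\sum_(k < N | k != n :> nat) kap j n * `|fcoef k|)).
    rewrite -mulr_sumr ler_wpM2l ?kap_ge0//.
    apply: (le_trans (ler_norm_sum _ _ _)); apply: ler_sum => k _.
    by rewrite scalefE normrM ler_piMr// sin_max.
  by apply: ler_sum => k _; rewrite ler_wpM2r// le_max lexx orbT.
have -> : y x - fcoef n * sin (kap j n * x) = (y x - (fcoef n * sinj j n x + rest)) +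
  rest.
  by rewrite /sinj /sinx; ring.
rewrite (le_trans (ler_wpM2l (kap_ge0 j n) (ler_normD _ _)))// mulrDr lerD//.
by rewrite mulrC -ler_pdivlMr.
Qed.

End Apriori.

End WeakProblem.

(** * Eigenfunctions near the constant coefficient ones *)

Section NearConstant.
Context {R : realType}.
Implicit Types (p q f g h y z : R -> R) (a c M : R) (j : bool).

Definition Lam (a1 a2 : R) j k : R := kap j k ^+ 4 + a1 * kap j k ^+ 2 + a2.

(** The second coefficient cancels in differences and is set to 0; one constant serves both boundary
    problems. *)
Definition spectral_gap (a1 gam : R) : Prop := 0 < gam /\
  forall j (k n : nat), k != n -> 0 < (kap j k : R) -> 0 < (kap j n : R) ->
  gam * `|k%:R - n%:R| * Num.max (kap j k) (kap j n) ^+ 3 <=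
    `|Lam a1 0 j k - Lam a1 0 j n|.

(** * Solutions with spectral parameter near a constant coefficient eigenvalue *)

Section Perturbation.
Variables (j : bool) (n : nat) (a1 a2 gam eps : R) (p q : R -> R).
Hypotheses (Lp : realL2 p) (Lq : realL2 q).
Hypotheses (kn1 : 1 <= (kap j n : R)) (Hgap : spectral_gap a1 gam).
Hypotheses (eps0 : 0 < eps) (eps_small : 32 * eps <= gam).
Hypotheses (Peps : nrm (p \- (fun=> a1)) <= eps) (Qeps : nrm (q \- (fun=> a2)) <= eps).

Section Estimates.
Variables (lam alpha : R) (y y1 y2 : R -> R).
Hypothesis lam_near : `|lam - Lam a1 a2 j n| <= gam / 2 * kap j n ^+ 2.
Hypothesis sol : weak_sol j p q lam (alpha *: sinj j n) y y1 y2.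

Let A : adm j y y1 y2. Proof. by case: sol. Qed.
Let b := fcoef j y n.
Let kn0 : 0 < (kap j n : R). Proof. exact: lt_le_trans kn1. Qed.
Let gam0 : 0 < gam. Proof. by case: Hgap. Qed.

(** Moving from [Lam n] to [lam] costs at most [gam / 2 kap n ^ 2], which is at most half of the gap
    because [kap n ^ 2 <= |k - n| K ^ 3]. *)
Let gap k : k != n -> 0 < (kap j k : R) ->
  gam / 2 * `|k%:R - n%:R| * Num.max (kap j k) (kap j n) ^+ 3 <=
  `|Lam a1 a2 j k - lam|.
Proof.
move=> kn k0; have [_ /(_ j k n kn k0 kn0)] := Hgap.
have Kn : (kap j n : R) <= Num.max (kap j k) (kap j n) by rewrite le_max lexx orbT.
move: (Num.max _ _) Kn => K Kn G.
have d1 : 1 <= `|k%:R - n%:R| :> R.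
  have [lt|gt|/eqP] := ltngtP k n; last by rewrite (negbTE kn).
    by rewrite distrC -natrB ?(ltnW lt)// ger0_norm// ler1n subn_gt0.
  by rewrite -natrB ?(ltnW gt)// ger0_norm// ler1n subn_gt0.
have E : Lam a1 0 j k - Lam a1 0 j n = (Lam a1 a2 j k - lam) + (lam - Lam a1 a2 j n).
  by rewrite /Lam; ring.
have := ler_normD (Lam a1 a2 j k - lam) (lam - Lam a1 a2 j n); rewrite -E => T.
have h : kap j n ^+ 2 <= `|k%:R - n%:R| * K ^+ 3.
  rewrite -[leLHS]mul1r ler_pM ?sqr_ge0// [K ^+ 3]exprS.
  rewrite -[leLHS]mul1r ler_pM ?sqr_ge0//; first exact: le_trans Kn.
  by rewrite lerXn2r ?nnegrE// ltW// (lt_le_trans kn0).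
have := ler_wpM2l (ltW gam0) h; move: lam_near T G; lra.
Qed.

(** Since [y 0 = 0], a bound on [y1] also bounds [y], so both perturbation terms are controlled by
    [eps M]. *)
Lemma apriori_sup_pos M : 0 < M -> (forall x, 0 <= x <= 1 -> `|y1 x| <= M) ->
  nrm ((p \- (fun=> a1)) \* y1) <= eps * M /\ nrm ((q \- (fun=> a2)) \* y) <= eps * M.
Proof.
move=> M0 yM.
have LP : realL2 (p \- (fun=> a1)) by apply: realL2B => //; exact: realL2_cst.
have LQ : realL2 (q \- (fun=> a2)) by apply: realL2B => //; exact: realL2_cst.
have sup0 x : 0 < x < 1 -> `|y1 x| <= M by move=> /andP[x0 x1]; apply: yM; rewrite !ltW.
have n1M : nrm y1 <= M by apply: nrm_le_sup (adm_L2_1 A) (ltW M0) sup0.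
have swap f g : f \* g = g \* f by apply/funext => x /=; rewrite mulrC.
rewrite !(swap _ y1) !(swap _ y) (mulrC eps); split.
  apply: (le_trans (nrmM_le_sup (adm_L2_1 A) LP _ (ltW M0) sup0)).
    by apply: cont01_realL2M => //; exact: adm_cont1 A.
  by rewrite ler_wpM2l// ltW.
have sup1 x : 0 < x < 1 -> `|y x| <= M.
  move=> /andP[x0 x1]; apply: le_trans n1M; apply: (adm_sup A).
  by rewrite !ltW.
apply: (le_trans (nrmM_le_sup (adm_L2 A) LQ _ (ltW M0) sup1)).
  by apply: cont01_realL2M => //; exact: adm_cont A.
by rewrite ler_wpM2l// ltW.
Qed.

Let tau := 32 * eps / gam.

(** With [M] the maximum of [|y1|] and [D = eps M], the derivative estimate at the maximum point
    reads [M <= kap n |b| + tau / 2 M], hence [M <= 2 kap n |b|] as [tau <= 1]. Substituted back,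
    this expresses all bounds through [|b|]; the 32 in [tau] is 8 from [tail_le], 2 from the halved
    gap and 2 from here. *)
Lemma apriori :
  [/\ forall x, 0 <= x <= 1 -> `|y1 x| <= 2 * kap j n * `|b|,
      `|(Lam a1 a2 j n - lam) * b - alpha| <= 8 * eps * kap j n ^+ 2 * `|b|,
      forall x, 0 <= x <= 1 -> `|y1 x - kap j n * b * cos (kap j n * x)| <= tau * `|b| &
      forall x, 0 <= x <= 1 -> kap j n * `|y x - b * sin (kap j n * x)| <= tau * `|b| ].
Proof.
have g20 : 0 < gam / 2 by rewrite divr_gt0.
have [x0 x0I HM] := cont01_sup (adm_cont1 A).
have := normr_ge0 (y1 x0); rewrite le_eqVlt => /predU1P[M0|M0].
  have Z1 x : 0 <= x <= 1 -> y1 x = 0.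
    by move=> /HM; rewrite -M0 normr_le0 => /eqP.
  have n10 : nrm y1 <= 0.
    apply: nrm_le_sup (adm_L2_1 A) (lexx 0) _ => x /andP[x0' x1].
    by rewrite Z1 ?normr0// !ltW.
  have Z0 x : 0 <= x <= 1 -> y x = 0.
    by move=> /(adm_sup A) /le_trans/(_ n10); rewrite normr_le0 => /eqP.
  have b0 : b = 0.
    rewrite /b /fcoef (_ : ip y _ = 0) ?mulr0// -[RHS](@ip0l _ (sinj j n)).
    by apply: eq_in_rint => x /andP[x0' x1] /=; rewrite Z0 ?mul0r ?mul0r// !ltW.
  (* If [y1 = 0], every [d > 0] is an admissible bound, so [main_coef] forces [alpha] to vanish as
     well. *)
  have E : (Lam a1 a2 j n - lam) * b - alpha = 0.
    apply: (@eq0_small _ _ (4 * kap j n * eps)) => d d0.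
    have dM x : 0 <= x <= 1 -> `|y1 x| <= d by move=> /Z1 ->; rewrite normr0 ltW.
    have [PD QD] := apriori_sup_pos d0 dM.
    have := main_coef Lp Lq sol kn1 (mulr_gt0 eps0 d0) PD QD; 
    by rewrite [leRHS](_ : _ = d * (4 * kap j n * eps)); last ring.
  split=> [x xI||x xI|x xI].
  - by rewrite Z1// b0 normr0 mulr0.
  - by rewrite E b0 normr0 mulr0.
  - by rewrite Z1// b0 normr0 !mulr0 mul0r subrr normr0.
  - by rewrite Z0// b0 normr0 mulr0 mul0r subrr normr0 mulr0.
have [PD QD] := apriori_sup_pos M0 HM.
set M := `|y1 x0| in M0 HM PD QD.
have D0 : 0 < eps * M by rewrite mulr_gt0.
have H1 := apriori_deriv Lp Lq sol g20 kn1 D0 gap PD QD.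
have H2 := apriori_fun Lp Lq sol g20 kn1 D0 gap PD QD.
have H3 := main_coef Lp Lq sol kn1 D0 PD QD.
rewrite -/b in H1 H2 H3.
set B := 8 * (eps * M) / (gam / 2 * kap j n) in H1 H2.
have BE : B = tau / 2 * M / kap j n.
  by rewrite /B /tau; field; rewrite !lt0r_neq0.
have tau1 : tau <= 1 by rewrite /tau ler_pdivrMr// mul1r.
have tau0 : 0 < tau by rewrite /tau divr_gt0// mulr_gt0.
have BM : B <= tau / 2 * M.
  have t0 : 0 <= tau / 2 * M by have := mulr_gt0 tau0 M0; lra.
  by rewrite BE ler_pdivrMr// ler_peMr.
have Mb : M <= 2 * kap j n * `|b|.
  have := H1 x0 x0I; have := ler_normB (y1 x0 - kap j n * b * cos (kap j n * x0)) (-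
    (kap j n * b * cos (kap j n * x0))).
  rewrite opprK subrK normrN -/M.
  have : `|kap j n * b * cos (kap j n * x0)| <= kap j n * `|b|.
    rewrite normrM (normrM (kap j n) b) (ger0_norm (kap_ge0 j n)).
    by rewrite ler_piMr ?cos_max// mulr_ge0// ltW.
  have := ler_wpM2r (ltW M0) tau1; lra.
have Bb : B <= tau * `|b|.
  rewrite BE ler_pdivrMr//; have := ler_wpM2l (ltW tau0) Mb; lra.
split=> [x xI||x xI|x xI].
- exact: le_trans (HM x xI) Mb.
- apply: (le_trans H3).
  have k4 : 0 <= 4 * kap j n * eps by have := mulr_gt0 kn0 eps0; lra.
  have := ler_wpM2l k4 Mb; lra.
- exact: le_trans (H1 x xI) Bb.
- exact: le_trans (H2 x xI) Bb.
Qed.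

End Estimates.

(* If (L - lam) u = sin_n were solvable for all lam near Lam_n, then
   lam |-> 1 / (u, sin_n) would be Lipschitz, of opposite signs at the two ends
   of the interval, and without zero. *)
Lemma not_always_solvable :
  ~ (forall lam, `|lam - Lam a1 a2 j n| <= gam / 2 * kap j n ^+ 2 ->
     exists y y1 y2, weak_sol j p q lam (1 *: sinj j n) y y1 y2).
Proof.
move=> H; set L := Lam a1 a2 j n in H; set r : R := gam / 2 * kap j n ^+ 2 in H.
have kn0 : 0 < (kap j n : R) by exact: lt_le_trans kn1.
have gam0 : 0 < gam by case: Hgap.
have r0 : 0 < r by rewrite mulr_gt0 ?divr_gt0 ?exprn_gt0.
(* Runs from [L - r] at 0 to [L + r] at 1; [clamp] keeps the values in the window for every real
   [t]. *)
pose lm (t : R) : R := L - r + 2 * r * clamp t.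
have lmI t : `|lm t - L| <= r.
  by have /andP[c0 c1] := clamp_itv t; rewrite /lm ler_norml; nra.
have /choice[Y HY] : forall t, exists Y : (R -> R) * (R -> R) * (R -> R),
    weak_sol j p q (lm t) (1 *: sinj j n) Y.1.1 Y.1.2 Y.2.
  by move=> t; have [y [y1 [y2 S]]] := H _ (lmI t); exists (y, y1, y2).
pose b t := fcoef j (Y t).1.1 n.
have small : 8 * eps * kap j n ^+ 2 <= r / 2.
  have : 0 <= kap j n ^+ 2 :> R by exact: sqr_ge0.
  by move=> k2; rewrite /r; have := ler_wpM2r k2 eps_small; lra.
have bE t : `|(L - lm t) * b t - 1| <= r / 2 * `|b t|.
  have [_ E _ _] := apriori (lmI t) (HY t).
  by apply: (le_trans E); rewrite ler_wpM2r.
have b0 t : b t != 0.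
  by apply/eqP => E; have := bE t; rewrite E mulr0 sub0r normr0 mulr0 normrN normr1 ler10.
have nb t : nrm (Y t).1.1 <= 2 * kap j n * `|b t|.
  have [S _] := HY t; have [E _ _ _] := apriori (lmI t) (HY t).
  have n1 : nrm (Y t).1.2 <= 2 * kap j n * `|b t|.
    apply: nrm_le_sup (adm_L2_1 S) _ _; first by rewrite !mulr_ge0 ?kap_ge0 ?pi_ge0.
    by move=> x /andP[x0 x1]; apply: E; rewrite !ltW.
  apply: nrm_le_sup (adm_L2 S) _ _; first by rewrite !mulr_ge0 ?kap_ge0 ?pi_ge0.
  move=> x /andP[x0 x1]; apply: le_trans n1; apply: (adm_sup S).
  by rewrite !ltW.
have Lsn := @realL2_sinj R j n.
(* Resolvent identity: each equation is tested with the other solution, and the symmetric forms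
   cancel. *)
have bdiff t s : b s - b t = 2 * (lm s - lm t) * ip (Y t).1.1 (Y s).1.1.
  have [St Et] := HY t; have [Ss Es] := HY s.
  have := Es _ _ _ St; have := Et _ _ _ Ss.
  rewrite /wform !scale1r /b /fcoef.
  have swp (f g h : R -> R) : ip (f \* g) h = ip (f \* h) g.
    by congr rint; apply/funext => x /=; rewrite mulrAC.
  rewrite (ipC (Y s).2 (Y t).2) (swp p (Y s).1.2) (swp q (Y s).1.1).
  rewrite (ipC (Y s).1.1 (Y t).1.1) (ipC (sinj j n) (Y t).1.1) (ipC (sinj j n) (Y s).1.1).
  lra.
(* The bounds [nb] contribute [|b t| |b s|], which cancels the denominator of the difference of
   inverses. *)
pose C : R := 8 * kap j n ^+ 2 * (2 * r).
have lip t s : `|(b t)^-1 - (b s)^-1| <= C * `|t - s|.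
  rewrite (_ : (b t)^-1 - (b s)^-1 = (b s - b t) / (b t * b s)); last first.
    by field; rewrite !b0.
  rewrite (normrM (b s - b t)) (normfV (b t * b s)) ler_pdivrMr; last first.
    by rewrite normr_gt0 mulf_neq0.
  rewrite bdiff (normrM (b t)) (normrM (2 * _)) (normrM 2) (ger0_norm (_ : 0 <= 2))//.
  have i1 : `|ip (Y t).1.1 (Y s).1.1| <= (2 * kap j n * `|b t|) * (2 * kap j n * `|b s|).
    have [St _] := HY t; have [Ss _] := HY s.
    apply: (le_trans (ip_le_nrm (adm_L2 St) (adm_L2 Ss))).
    by rewrite ler_pM ?nrm_ge0.
  have l1 : `|lm s - lm t| <= 2 * r * `|t - s|.
    rewrite (_ : lm s - lm t = 2 * r * (clamp s - clamp t)); last by rewrite /lm; ring.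
    have r20 : 0 <= 2 * r by lra.
    by rewrite (normrM (2 * r)) (ger0_norm r20) (distrC t) ler_wpM2l ?clamp_lip.
  rewrite (_ : C * _ * _ = 2 * (2 * r * `|t - s|) * ((2 * kap j n * `|b t|) * (2 *
    kap j n * `|b s|))); last first.
    by rewrite /C; ring.
  by rewrite ler_pM ?mulr_ge0 ?ler_wpM2l.
have ch := lipschitz_continuous lip.
have lm0 : L - lm 0 = r by rewrite /lm clamp_id ?lexx ?ler01//; ring.
have lm1 : L - lm 1 = - r by rewrite /lm clamp_id ?lexx ?ler01//; ring.
have := bE 0; have := bE 1; rewrite lm0 lm1.
move=> B1 B0.
(* A negative [b 0] would give [|r b - 1| > r |b|], against [B0]; the other end is symmetric. *)
have p0 : 0 < (b 0)^-1.
  rewrite invr_gt0; have := b0 0; rewrite neq_lt => /orP[b0n|//].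
  move: B0; rewrite (ltr0_norm b0n) ler_norml => /andP[+ _]; nra.
have n1 : (b 1)^-1 < 0.
  rewrite invr_lt0; have := b0 1; rewrite neq_lt => /orP[//|b1p].
  move: B1; rewrite (gtr0_norm b1p) ler_norml => /andP[+ _]; nra.
have [||c _ /eqP] := @IVT _ (fun t => (b t)^-1) 0 1 0 ler01.
- exact: continuous_subspaceT.
- by rewrite ge_min le_max (ltW p0) (ltW n1) orbT.
- by rewrite invr_eq0 (negbTE (b0 c)).
Qed.

End Perturbation.

(** * The spectral gap from nondegeneracy *)

Lemma finite_separation (x : nat -> R) N : exists2 c, 0 < c &
  forall k, (k < N)%N -> x k != 0 -> c <= `|x k|.
Proof.
elim: N => [|N [c c0 IH]]; first by exists 1.
have [xN|xN] := eqVneq (x N) 0.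
  exists c => // k; rewrite ltnS leq_eqVlt => /predU1P[->|]; last exact: IH.
  by rewrite xN eqxx.
exists (Num.min c `|x N|); first by rewrite lt_min c0 normr_gt0.
move=> k; rewrite ltnS leq_eqVlt => /predU1P[-> _|kN xk];
  first by rewrite ge_min lexx orbT.
by rewrite ge_min IH.
Qed.

(** The difference of eigenvalues is [(kap k - kap n) (kap k + kap n) (kap k ^ 2 + kap n ^ 2 + a1)].
    The last factor is some [x m] with [m] a natural number; being nonzero, it is bounded below by a
    multiple of [kap k ^ 2 + kap n ^ 2], with finitely many [m] to inspect. *)
Lemma gap_exists a1 :
  (forall j (k n : nat), k != n -> 0 < (kap j k : R) -> 0 < (kap j n : R) ->
     kap j k ^+ 2 + kap j n ^+ 2 + a1 != 0) ->
  exists gam, spectral_gap a1 gam.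
Proof.
move=> ndg; pose x (N : nat) : R := (pi / 2) ^+ 2 * N%:R + a1.
have pi1 : 1 <= pi / 2 :> R by exact: pihalf_ge1.
have p2 : 1 <= (pi / 2) ^+ 2 :> R by rewrite exprn_ege1.
pose N := (Num.truncn (2 * `|a1|)).+1.
have NP : 2 * `|a1| < N%:R by rewrite truncnS_gt.
have [c c0 Hc] := finite_separation x N.
have N0 : 0 < N%:R :> R by rewrite ltr0n.
(* beyond N the term a1 is at most half of the other one *)
have sep m : x m != 0 -> Num.min (c / ((pi / 2) ^+ 2 * N%:R)) 2^-1 * ((pi / 2) ^+ 2 *
  m%:R) <= `|x m|.
  move=> xm; have P0 : 0 < (pi / 2) ^+ 2 :> R by exact: lt_le_trans p2.
  have Pm : 0 <= (pi / 2) ^+ 2 * m%:R :> R by rewrite mulr_ge0// ltW.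
  have [mN|Nm] := ltnP m N.
    apply: le_trans (Hc m mN xm).
    apply: (@le_trans _ _ (c / ((pi / 2) ^+ 2 * N%:R) * ((pi / 2) ^+ 2 * m%:R))).
      by rewrite ler_wpM2r// ge_min lexx.
    have PN : 0 < (pi / 2) ^+ 2 * N%:R :> R by rewrite mulr_gt0.
    rewrite mulrAC ler_pdivrMr// ler_wpM2l ?(ltW c0)//.
    by rewrite ler_wpM2l ?(ltW P0)// ler_nat ltnW.
  apply: (@le_trans _ _ (2^-1 * ((pi / 2) ^+ 2 * m%:R))).
    by rewrite ler_wpM2r// ge_min lexx orbT.
  have : N%:R <= m%:R :> R by rewrite ler_nat.
  have : m%:R <= (pi / 2) ^+ 2 * m%:R :> R by rewrite ler_peMl.
  have := ler_norm (x m); have := ler_norm (- a1); rewrite normrN /x; lra.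
pose gam : R := Num.min (c / ((pi / 2) ^+ 2 * N%:R)) 2^-1.
have gam0 : 0 < gam.
  by rewrite lt_min invr_gt0 ltr0n andbT divr_gt0// mulr_gt0// (lt_le_trans _ p2).
exists gam; split => // j k n kn k0 n0.
have E : kap j k ^+ 2 + kap j n ^+ 2 + a1 = x ((k.*2 + j) ^ 2 + (n.*2 + j) ^ 2)%N.
  by rewrite /x /kap [in RHS]natrD !natrX; field.
have := sep ((k.*2 + j) ^ 2 + (n.*2 + j) ^ 2)%N;
  rewrite -E -/gam => /(_ (ndg _ _ _ kn k0 n0)).
rewrite (_ : (pi / 2) ^+ 2 * _ = kap j k ^+ 2 + kap j n ^+ 2); last first.
  by rewrite /kap [in LHS]natrD !natrX; field.
move=> S.
have -> : Lam a1 0 j k - Lam a1 0 j n =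
    (kap j k - kap j n) * ((kap j k + kap j n) * (kap j k ^+ 2 + kap j n ^+ 2 + a1)).
  by rewrite /Lam; ring.
have -> : kap j k - kap j n = pi * (k%:R - n%:R) :> R.
  by rewrite /kap -!muln2 !natrD !natrM; field.
move: k0 n0 S; move: (kap j k : R) (kap j n : R) (_ + a1) => u v X u0 v0 S.
rewrite normrM (normrM pi) (normrM (u + v)) (gtr0_norm (pi_gt0 R)) (gtr0_norm
  (addr_gt0 u0 v0)).
set w : R := `|k%:R - n%:R|; have w0 : 0 <= w by exact: normr_ge0.
have K1 : Num.max u v <= u + v by rewrite ge_max; apply/andP; split; lra.
have K2 : Num.max u v ^+ 2 <= u ^+ 2 + v ^+ 2.
  by case: (leP u v) => _; rewrite ?lerDr ?lerDl sqr_ge0.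
have K0 : 0 < Num.max u v by rewrite lt_max u0.
move: (Num.max u v) K0 K1 K2 => K K0 K1 K2.
have h1 : gam * K ^+ 2 <= `|X| by apply: le_trans S; rewrite ler_wpM2l// ltW.
have h2 : K * (gam * K ^+ 2) <= (u + v) * `|X|.
  have g2 : 0 <= gam * K ^+ 2 by rewrite (mulr_ge0 (ltW gam0))// sqr_ge0.
  by apply: ler_pM => //; exact: ltW.
have h3 : w <= pi * w by rewrite ler_peMl// (le_trans _ (pi_ge2 R))// ler1n.
rewrite (_ : gam * w * K ^+ 3 = w * (K * (gam * K ^+ 2))); last by ring.
have g3 : 0 <= K * (gam * K ^+ 2) by rewrite (mulr_ge0 (ltW K0))// (mulr_ge0 (ltW
  gam0))// sqr_ge0.
by apply: ler_pM.
Qed.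

End NearConstant.

(** * The complex operators *)

Local Open Scope complex_scope.

Section ComplexOperator.
Context {R : realType}.
Implicit Types (p q y z : R -> R) (u f : R -> R[i]) (j b : bool).

(** Treats real and imaginary parts at once: the coefficients are real, so both parts solve the same
    real problem. *)
Definition part b (z : R[i]) : R := if b then complex.Im z else complex.Re z.
Definition ofreal (g : R -> R) : R -> R[i] := fun x => (g x)%:C.

Lemma partD b (z w : R[i]) : part b (z + w) = part b z + part b w.
Proof. by case: b; case: z; case: w. Qed.

Lemma partZ b (c : R) (z : R[i]) : part b (c%:C * z) = c * part b z.
Proof. by case: b; case: z => x y /=; rewrite mul0r ?addr0 ?subr0. Qed.

Lemma ae01S (T U : Type) (f g : R -> T) (f' g' : R -> U) :
  (forall x : R, 0 < x < 1 -> f x = g x -> f' x = g' x) -> ae01 f g -> ae01 f' g'.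
Proof.
move=> H; apply: filterS; first exact: (ae_filter_ringOfSetsType (@lebesgue_measure R)).
move=> x fg xI; apply: H; last exact: fg.
by move: xI; rewrite /I01/= in_itv.
Qed.

Lemma ae01S2 (T U V : Type) (f g : R -> T) (f' g' : R -> U) (f'' g'' : R -> V) :
  (forall x, f x = g x -> f' x = g' x -> f'' x = g'' x) ->
  ae01 f g -> ae01 f' g' -> ae01 f'' g''.
Proof.
move=> H; apply: filterS2; first exact: (ae_filter_ringOfSetsType (@lebesgue_measure R)).
by move=> x fg fg' xI; apply: H; [exact: fg|exact: fg'].
Qed.

Lemma ae01_refl (T : Type) (f : R -> T) : ae01 f f.
Proof. by apply: filterE;
  first exact: (ae_filter_ringOfSetsType (@lebesgue_measure R)). Qed.

Lemma part_inj (z w : R[i]) : (forall b, part b z = part b w) -> z = w.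
Proof. by case: z w => a b [c d] H; have := H true; have := H false => /= -> ->. Qed.

Lemma partJM b (z : R[i]) (c : R) : part b (z * (c%:C)^*) = part b z * c.
Proof.
case: b; case: z => x y /=; rewrite /Num.conj/= ?oppr0 ?mulr0 ?subr0 ?add0r//.
Qed.

Lemma part_Cintegral b (D : set R) f :
  part b (Cintegral D f) = \int[@lebesgue_measure R]_(x in D) (part b (f x)).
Proof. by case: b. Qed.

Lemma part_inner b f (g : R -> R) : part b (inner f (ofreal g)) = ip (part b \o f) g.
Proof.
by rewrite /inner part_Cintegral; congr rint; apply/funext => x; rewrite partJM.
Qed.

Definition Qj j : set (H2 R) := if j then @Q2 R else @Q1 R.
Definition Lj j (p : potentials R) : operator R := form_operator (Qj j) p.

Lemma L2_part b f : L2 f -> realL2 (part b \o f).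
Proof. by case: b => -[]. Qed.

Lemma part_prim b F f :
  (forall x : R, 0 <= x <= 1 -> F x = F 0 + Cintegral `]0, x[ f) ->
  prim (part b \o F) (part b \o f).
Proof. by move=> H x xI; rewrite /= (H x xI) partD part_Cintegral. Qed.

Lemma part_adm j b (Y : H2 R) : Qj j Y ->
  adm j (part b \o H2fun Y) (part b \o H2d1 Y) (part b \o H2d2 Y).
Proof.
move=> QY; split.
- by apply: L2_part; exact: H2d2_L2.
- by apply: part_prim; exact: H2d1_primitive.
- by apply: part_prim; exact: H2fun_primitive.
- by case: j QY => -[/= -> ->]; case: b.
Qed.

Lemma ofreal_prim (y y1 : R -> R) : prim y y1 -> forall x : R, 0 <= x <= 1 ->
  ofreal y x = ofreal y 0 + Cintegral `]0, x[ (ofreal y1).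
Proof.
move=> P x xI; apply: part_inj => b; rewrite partD part_Cintegral.
case: b => /=; last exact: P.
by rewrite /Rintegral integral0 addr0.
Qed.

Lemma adm_H2 j y y1 y2 : adm j y y1 y2 -> exists Z : H2 R,
  [/\ Qj j Z, H2fun Z = ofreal y, H2d1 Z = ofreal y1 & H2d2 Z = ofreal y2].
Proof.
move=> [L P1 P0 [y0 yb]].
have L2y : L2 (ofreal y2) by split => //; exact: (realL2_cst 0).
exists (MkH2 L2y (ofreal_prim P1) (ofreal_prim P0)); split=> //.
by case: j yb => yb; split; rewrite /= /ofreal ?y0 ?yb.
Qed.

Lemma part_quad_form b p q (Y Z : H2 R) z z1 z2 :
  H2fun Z = ofreal z -> H2d1 Z = ofreal z1 -> H2d2 Z = ofreal z2 ->
  part b (quad_form (p, q) Y Z) =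
  wform p q (part b \o H2fun Y) (part b \o H2d1 Y) (part b \o H2d2 Y) z z1 z2.
Proof.
move=> E0 E1 E2; rewrite /quad_form E0 E1 E2 !partD !part_inner /wform.
by congr (_ + ip _ _ + ip _ _); apply/funext => x; rewrite /= partZ.
Qed.

Lemma ae_part b u f : ae01 u f -> ae01 (part b \o u) (part b \o f).
Proof.
by apply: ae01S => x _ /= ->.
Qed.

Lemma ae_ip (g h z : R -> R) : realL2 g -> realL2 h -> realL2 z -> ae01 g h ->
  ip g z = ip h z.
Proof.
move=> Lg Lh Lz gh; apply: ae_eq_rint.
- by apply: measurable_funM; exact: realL2_meas.
- by apply: measurable_funM; exact: realL2_meas.
- by move: gh; apply: ae01S => x _ /= ->.
Qed.

Lemma Lj_weak j b p q u f : Lj j (p, q) u f -> exists y y1 y2,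
  [/\ adm j y y1 y2, ae01 (part b \o u) y, realL2 (part b \o u) &
    forall z z1 z2, adm j z z1 z2 ->
      wform p q y y1 y2 z z1 z2 = ip (part b \o f) z].
Proof.
move=> [Lu Lf [Y [QY uY form]]].
exists (part b \o H2fun Y), (part b \o H2d1 Y), (part b \o H2d2 Y); split.
- exact: part_adm.
- exact: ae_part.
- exact: L2_part.
- move=> z z1 z2 Az; have [Z [QZ E0 E1 E2]] := adm_H2 Az.
  by rewrite -(part_quad_form b p q Y E0 E1 E2) form// E0 part_inner.
Qed.

Lemma resolvent_weak j p q n (lam : R) u :
  Lj j (p, q) u (fun x => ofreal (sinj j n) x + lam%:C * u x) ->
  exists y y1 y2, weak_sol j p q lam (1 *: sinj j n) y y1 y2.
Proof.
move=> /(Lj_weak false)[y [y1 [y2 [A uy Lu form]]]].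
exists y, y1, y2; split=> // z z1 z2 Az; rewrite form//.
have Lz := adm_L2 Az; have Ls := @realL2_sinj R j n.
rewrite (_ : _ \o _ = sinj j n + lam *: (part false \o u)).
  rewrite ipDl//; last exact: realL2Z.
  by rewrite ipZl// scale1r (ae_ip Lu (adm_L2 A) Lz uy).
by apply/funext => x; rewrite /comp partD partZ.
Qed.

(** If both parts of [u] had vanishing representatives, [u] would vanish a.e. The right-hand side 0
    is written as a multiple of a sine to match the a priori estimates. *)
Lemma eigen_weak j p q n (lam : R) u : eigspace (Lj j (p, q)) lam%:C u ->
  ~ ae01 u (fun=> 0) ->
  exists y y1 y2, weak_sol j p q lam (0 *: sinj j n) y y1 y2 /\
    exists2 x, 0 <= x <= 1 & y x != 0.
Proof.
move=> E u0; apply: contrapT => H; apply: u0.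
suff Z b : ae01 (part b \o u) (fun=> 0).
  move: (Z true) (Z false); apply: ae01S2 => x H1 H2; apply: part_inj => b.
  by case: b.
have [y [y1 [y2 [A uy Lu form]]]] := Lj_weak b E.
have S : weak_sol j p q lam (0 *: sinj j n) y y1 y2.
  split=> // z z1 z2 Az; rewrite form// scale0r ip0l add0r.
  rewrite (_ : _ \o _ = lam *: (part b \o u)).
    by rewrite ipZl// ?(ae_ip Lu (adm_L2 A) (adm_L2 Az) uy)//; exact: adm_L2 Az.
  by apply/funext => x; rewrite /comp partZ.
have y0 x : 0 <= x <= 1 -> y x = 0.
  move=> xI; apply/eqP/negPn/negP => yx; apply: H.
  by exists y, y1, y2; split=> //; exists x.
by move: uy; apply: ae01S => x /andP[x0 x1] ->; rewrite y0// !ltW.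
Qed.

(** The multiplicity of [l k] counts the indices with that value, [k] among them, so it is positive;
    uniqueness of coordinates makes a basis vector nonzero. *)
Lemma listing_nonzero (T : operator R) (l : nat -> R) k :
  spectrum_listing T l -> is_eigenvalue T (l k)%:C.
Proof.
move=> [_ _ /(_ k)[m [e [He uniq]] card]].
case: m e He uniq card => [|m] e He uniq card.
  exfalso; have := card; rewrite II0 card_eq0 => /eqP E.
  by have : [set k' | l k' = l k] k by []; rewrite E.
exists (e ord0); first exact: He.
move=> e0; have [c [_ cu]] := uniq _ (He ord0).
pose c1 (t : R[i]) := [ffun i : 'I_m.+1 => if i == ord0 then t else 0].
have H t : ae01 (e ord0) (fun x => \sum_(i < m.+1) c1 t i * e i x).
  move: e0; apply: ae01S => x _ H;
    rewrite H// (bigD1 ord0)//= ffunE eqxx H// mulr0 add0r big1// => i i0.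
  by rewrite ffunE (negbTE i0) mul0r.
(* Were the first vector zero, its coordinates could start with 0 or with 1. *)
have := cu _ (H 0); rewrite (cu _ (H 1)) => /ffunP/(_ ord0).
by rewrite !ffunE eqxx => /eqP; rewrite oner_eq0.
Qed.

Lemma listing_spectrum (T : operator R) (l : nat -> R) (lam : R) :
  spectrum_listing T l -> spectrum T lam%:C -> exists k, l k = lam.
Proof. by move=> [_ -> _] [k _ /complexI E]; exists k. Qed.

(** Otherwise the whole window lies in the resolvent set, and surjectivity solves the equation with
    the n-th sine for every [lam] there, against [not_always_solvable]. *)
Lemma spectral_point j n (a1 a2 gam eps : R) p q :
  realL2 p -> realL2 q -> 1 <= (kap j n : R) -> spectral_gap a1 gam ->
  0 < eps -> 32 * eps <= gam ->
  nrm (p \- (fun=> a1)) <= eps -> nrm (q \- (fun=> a2)) <= eps ->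
  exists2 lam : R, `|lam - Lam a1 a2 j n| <= gam / 2 * kap j n ^+ 2 &
    spectrum (Lj j (p, q)) lam%:C.
Proof.
move=> Lp Lq kn1 G e0 eg Pe Qe; apply: contrapT => H.
apply: (not_always_solvable Lp Lq kn1 G e0 eg Pe Qe) => lam near.
have [surj _] : resolvent_set (Lj j (p, q)) lam%:C.
  by apply: contrapT => N; apply: H; exists lam.
have [|u] := surj (ofreal (sinj j n)); last exact: resolvent_weak.
by split; [exact: realL2_sinj|exact: (realL2_cst 0)].
Qed.

Lemma inner_real_l (g : R -> R) f : realL2 g -> L2 f ->
  inner (ofreal g) f = ip g (part false \o f) +i* (- ip g (part true \o f)).
Proof.
move=> Lg Lf; rewrite -ipNl//; last exact: L2_part.
congr Complex; congr rint; apply/funext => x; rewrite /ofreal /=; case: (f x) => s t /=.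
  by rewrite mul0r subr0.
by rewrite mul0r addr0 mulrN mulNr.
Qed.

Lemma sin_wform j k (a1 a2 : R) z z1 z2 : adm j z z1 z2 ->
  ip (- kap j k ^+ 2 *: sinj j k) z2 + ip (a1 *: (kap j k *: cosj j k)) z1 +
    ip (a2 *: sinj j k) z = Lam a1 a2 j k * ip (sinj j k) z.
Proof.
move=> A; have Ls := @realL2_sinj R j k; have Lc := @realL2_cosj R j k.
have L0 := adm_L2 A; have L1 := adm_L2_1 A; have L2 := adm_L2_2 A.
rewrite (ipZl _ Ls L2) (ipZl _ (realL2Z _ Lc) L1) (ipZl _ Lc L1) (ipZl _ Ls L0).
rewrite (ipC _ z2) (adm_sin A) (ipC _ z1) (adm_cos A) (ipC _ z) /Lam.
by ring.
Qed.

Lemma sin_eigen j k (a1 a2 : R) :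
  eigspace (Lj j (fun=> a1, fun=> a2)) (Lam a1 a2 j k)%:C (ofreal (sinj j k)).
Proof.
have Ls := @realL2_sinj R j k; have Lc := @realL2_cosj R j k.
have Lr (g : R -> R) : realL2 g -> L2 (ofreal g) by move=> Lg; split=> //;
  exact: (realL2_cst 0).
have mulE (c : R) (g : R -> R) : (fun x => c%:C * ofreal g x) = ofreal (c *: g).
  by apply/funext => x; apply: part_inj => b; rewrite partZ; case: b => /=;
    rewrite ?mulr0.
split; [exact: Lr|by rewrite mulE; apply: Lr; exact: realL2Z|].
have [S [QS E0 E1 E2]] := adm_H2 (adm_sinj j k).
exists S; split=> //; first by rewrite E0; exact: ae01_refl.
move=> Z QZ; have A0 := part_adm false QZ; have A1 := part_adm true QZ.
rewrite /quad_form E0 E1 E2 /= !mulE.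
have LZ2 := H2d2_L2 Z.
have LZ1 : L2 (H2d1 Z) by split; [exact: (adm_L2_1 A0)|exact: (adm_L2_1 A1)].
have LZ0 : L2 (H2fun Z) by split; [exact: (adm_L2 A0)|exact: (adm_L2 A1)].
rewrite !inner_real_l//; do ?[exact: realL2Z|by do 2 apply: realL2Z].
have h0 := sin_wform k a1 a2 A0; have h1 := sin_wform k a1 a2 A1.
apply: part_inj => -[]; rewrite !partD /=.
  rewrite -!opprD h1 ipZl//; exact: adm_L2 A1.
by rewrite h0 ipZl//; exact: adm_L2 A0.
Qed.

Lemma sinj_neq0 j k : 0 < (kap j k : R) -> ip (sinj j k) (sinj j k) = 2^-1 :> R.
Proof.
move=> k0; rewrite ip_sinj eqxx (_ : (k + k + j == 0)%N = false) ?subr0 ?mul1r//.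
apply/negbTE; apply: contraL k0 => /eqP; case: k => [|//]; case: j => //= _.
by rewrite /kap mulr0 mul0r ltxx.
Qed.

(** If the sum vanished, the two eigenvalues would coincide by the factorization of their
    difference, and two orthogonal nonzero sines would share a one-dimensional eigenspace. *)
Lemma simple_nondegenerate j (a1 a2 : R) :
  only_simple_eigenvalues (Lj j (fun=> a1, fun=> a2)) ->
  forall k n : nat, k != n -> 0 < (kap j k : R) -> 0 < (kap j n : R) ->
  kap j k ^+ 2 + kap j n ^+ 2 + a1 != 0.
Proof.
move=> simple k n kn k0 n0; apply/eqP => E.
have LE : Lam a1 a2 j n = Lam a1 a2 j k.
  have -> : a1 = - (kap j k ^+ 2 + kap j n ^+ 2) by apply/eqP; rewrite -addr_eq0 addrC E.
  by rewrite /Lam; ring.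
have Lk := @realL2_sinj R j k; have Ln := @realL2_sinj R j n.
have nz i : 0 < (kap j i : R) -> ~ ae01 (ofreal (sinj j i)) (fun=> 0).
  move=> i0 /(ae_part false) H; have Li := @realL2_sinj R j i.
  have := ae_ip Li (realL2_cst 0) Li H; rewrite sinj_neq0// (_ : (fun=> 0) = 0)// ip0l.
  by move=> /eqP; rewrite invr_eq0 pnatr_eq0.
have ek := sin_eigen j k a1 a2; have en := sin_eigen j n a1 a2; rewrite LE in en.
have [e [_ uniq]] := simple _ (ex_intro2 _ _ _ ek (nz k k0)).
have [ck [Ek _]] := uniq _ ek; have [cn [En _]] := uniq _ en.
(* Both sines are multiples of one basis vector; eliminating it and pairing with the k-th sine gives
   [cn ord0 = 0]. *)
have cross : ae01 (fun x => cn ord0 * ofreal (sinj j k) x) (fun x => ck ord0 * ofreal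
  (sinj j n) x).
  by move: Ek En; apply: ae01S2 => x; rewrite !big_ord1 => -> ->; rewrite mulrCA.
suff cn0 : cn ord0 = 0.
  apply: (nz n n0); move: En; apply: ae01S => x _ ->.
  by rewrite big_ord1 cn0 mul0r.
apply: part_inj => b;
  have partE (c : R[i]) (g : R -> R) : part b \o (fun x => c * ofreal g x) = part b c
    *: g.
  by apply/funext => x; rewrite /comp mulrC partZ mulrC.
have := ae_part b cross; rewrite !partE => /(ae_ip (realL2Z _ Lk) (realL2Z _ Ln) Lk).
rewrite ipZl// ipZl// sinj_neq0// sinj_ortho 1?eq_sym// mulr0 => /eqP.
rewrite mulf_eq0 invr_eq0 pnatr_eq0 orbF => /eqP ->.
by case: b {partE}.
Qed.

End ComplexOperator.

(** * Isospectral coefficients *)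

Section Conclusion.
Context {R : realType}.
Implicit Types (p q f y z u v w t : R -> R) (j : bool).

Lemma perturbed_cos_complete f (sg tau : R) : realL2 f -> sg ^+ 2 = 1 ->
  0 <= tau -> tau ^+ 2 * 4 < 1 ->
  (forall m, `|ip f (cosm 0) + sg * ip f (cosm m.+1)| <= tau / m.+1%:R * nrm f) ->
  ip f f = 0.
Proof.
move=> Lf sg1 tau0 tau1 H.
set A := ip f (cosm 0); set I := ip f f.
have I0 : 0 <= I by exact: ip_ge0.
have key N : N%:R * A ^+ 2 <= 2 * I + 4 * tau ^+ 2 * I.
  have -> : N%:R * A ^+ 2 = \sum_(m < N) A ^+ 2 by rewrite sumr_const card_ord mulr_natl.
  apply: (@le_trans _ _ (\sum_(m < N) (2 * ip f (cosm m.+1) ^+ 2 +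
      2 * tau ^+ 2 * I * (m.+1%:R ^+ 2)^-1))).
    apply: ler_sum => m _; set c := ip f (cosm m.+1).
    have Hm : (A + sg * c) ^+ 2 <= tau ^+ 2 * (m.+1%:R ^+ 2)^-1 * I.
      rewrite -(real_normK (num_real (A + _))).
      have -> : tau ^+ 2 * (m.+1%:R ^+ 2)^-1 * I = (tau / m.+1%:R * nrm f) ^+ 2.
        by rewrite !exprMn nrm_sqr exprVn.
      by rewrite lerXn2r ?nnegrE ?mulr_ge0 ?invr_ge0 ?nrm_ge0// H.
    have : A ^+ 2 <= 2 * (A + sg * c) ^+ 2 + 2 * (sg ^+ 2 * c ^+ 2).
      by have := sqr_ge0 (A + 2 * sg * c); nra.
    by rewrite sg1; move: Hm; set X := _^-1; lra.
  rewrite big_split/= -!mulr_sumr.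
  have h1 : \sum_(m < N) ip f (cosm m.+1) ^+ 2 <= I.
    have := bessel_cosj false N.+1 Lf; rewrite big_ord_recl/= -/I.
    under eq_bigr => m _ do rewrite -cosm_cosj /bump/= add1n.
    by apply: le_trans; rewrite lerDr sqr_ge0.
  have := @sum_inv_sqr R N; set S := \sum_(m < N) _^-1 => h2.
  have t0 : 0 <= 2 * tau ^+ 2 * I by rewrite mulr_ge0// mulr_ge0// sqr_ge0.
  have := ler_wpM2l t0 h2; lra.
have A0 : A = 0.
  apply/eqP/negPn/negP => An; have A2 : 0 < A ^+ 2 by rewrite exprn_even_gt0.
  have := key (Num.truncn ((2 * I + 4 * tau ^+ 2 * I) / A ^+ 2)).+1.
  by rewrite -ler_pdivlMr// leNgt truncnS_gt.
apply: (parseval_perturbed Lf A0 tau0 tau1) => m.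
have := H m; rewrite -/A A0 add0r normrM.
have -> : `|sg| = 1; last by rewrite mul1r.
by apply/eqP; rewrite -sqrp_eq1 ?real_normK ?num_real ?sg1.
Qed.

(** The coefficient [b] is nonzero, since [apriori] would otherwise force [y1 = 0] and then [y = 0];
    its estimates are divided by [b]. *)
Lemma eigen_normalized j n (a1 a2 gam eps lam : R) p q y y1 y2 :
  realL2 p -> realL2 q -> 1 <= (kap j n : R) -> spectral_gap a1 gam ->
  0 < eps -> 32 * eps <= gam ->
  nrm (p \- (fun=> a1)) <= eps -> nrm (q \- (fun=> a2)) <= eps ->
  `|lam - Lam a1 a2 j n| <= gam / 2 * kap j n ^+ 2 ->
  weak_sol j p q lam (0 *: sinj j n) y y1 y2 ->
  (exists2 x, 0 <= x <= 1 & y x != 0) ->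
  exists2 b : R, b != 0 & forall x, 0 <= x <= 1 ->
    `|((kap j n * b)^-1 *: y1) x - cosj j n x| <= 32 * eps / gam / kap j n /\
    `|(b^-1 *: y) x - sinj j n x| <= 32 * eps / gam / kap j n.
Proof.
move=> Lp Lq kn1 G e0 eg Pe Qe near S [x0 x0I yx0].
have kn0 : 0 < (kap j n : R) by exact: lt_le_trans kn1.
have [H1 _ H3 H4] := apriori Lp Lq kn1 G e0 eg Pe Qe near S.
move: (fcoef j y n) H1 H3 H4 => b H1 H3 H4.
have b0 : b != 0.
  apply/eqP => b0; move/eqP: yx0; apply; apply/eqP; rewrite -normr_le0.
  have [A _] := S; apply: (le_trans (adm_sup A x0I)).
  apply: nrm_le_sup (adm_L2_1 A) (lexx 0) _ => x /andP[x1 x2].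
  by have := H1 x; rewrite b0 normr0 mulr0; apply; rewrite !ltW.
exists b => // x xI; rewrite !scalefE; split.
- rewrite (_ : _ - _ = (y1 x - kap j n * b * cos (kap j n * x)) / (kap j n * b));
  last first.
    by rewrite /cosj /cosx; field; rewrite b0 lt0r_neq0.
  have kb0 : 0 < `|kap j n * b| by rewrite normr_gt0 (mulf_neq0 (lt0r_neq0 kn0) b0).
  rewrite normrM (normfV (kap j n * b)) (ler_pdivrMr _ _ kb0).
  rewrite (normrM (kap j n) b) (gtr0_norm kn0) mulrA (divfK (lt0r_neq0 kn0)).
  exact: H3.
- rewrite (_ : _ - _ = (y x - b * sin (kap j n * x)) / b); last first.
    by rewrite /sinj /sinx; field.
  rewrite normrM (normfV b) ler_pdivrMr ?normr_gt0//.
  by rewrite [leRHS]mulrAC ler_pdivlMr// mulrC; exact: H4.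
Qed.

(** [u v - c ^ 2 = (u - c) (v - c) + c ((u - c) + (v - c))] is at most [d + 2 d] in absolute
    value. *)
Lemma product_estimate f (c u v : R -> R) (d : R) : realL2 f ->
  cont01 c -> cont01 u -> cont01 v -> d <= 1 ->
  (forall x, 0 <= x <= 1 -> [/\ `|c x| <= 1, `|u x - c x| <= d & `|v x - c x| <= d]) ->
  ip f (u \* v) = 0 -> `|ip f (c \* c)| <= nrm f * (3 * d).
Proof.
move=> Lf cc cu cv d1 H uv0.
have d0 : 0 <= d.
  have [|_ + _] := H 0; first by rewrite lexx ler01.
  exact: le_trans.
have Lcc : realL2 (c \* c) by apply: cont01_realL2; exact: cont01M.
have Luv : realL2 (u \* v) by apply: cont01_realL2; exact: cont01M.
have -> : ip f (c \* c) = ip f (c \* c - u \* v) by rewrite ipBr// uv0 subr0.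
apply: (le_trans (ip_le_nrm Lf (realL2B Lcc Luv))).
rewrite ler_wpM2l ?nrm_ge0//; apply: nrm_le_sup; [exact: realL2B|exact: mulr_ge0|].
move=> x /andP[x0 x1]; have [|c1 ud vd] := H x; first by rewrite !ltW.
rewrite addfE oppfE /= (_ : _ - _ = - ((u x - c x) * (v x - c x) + c x * ((u x - c x)
  + (v x - c x)))); last by ring.
rewrite normrN (le_trans (ler_normD _ _))// !normrM.
have h1 : `|u x - c x| * `|v x - c x| <= d * 1.
  by rewrite ler_pM// (le_trans vd).
have h2 : `|c x| * `|(u x - c x) + (v x - c x)| <= 1 * (d + d).
  by rewrite ler_pM// (le_trans (ler_normD _ _))// lerD.
lra.
Qed.

(** * Orthogonality relations between two isospectral pairs *)

Section IsoSpectral.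
Variables (a1 a2 gam eps : R) (p1 q1 p2 q2 : R -> R).
Hypotheses (Lp1 : realL2 p1) (Lq1 : realL2 q1) (Lp2 : realL2 p2) (Lq2 : realL2 q2).
Hypotheses (G : spectral_gap a1 gam) (e0 : 0 < eps) (eg : 1000 * eps <= gam).
Hypotheses (Pe1 : nrm (p1 \- (fun=> a1)) <= eps) (Qe1 : nrm (q1 \- (fun=> a2)) <= eps).
Hypotheses (Pe2 : nrm (p2 \- (fun=> a1)) <= eps) (Qe2 : nrm (q2 \- (fun=> a2)) <= eps).
Variable l : bool -> nat -> R.
Hypothesis l1 : forall j, spectrum_listing (Lj j (p1, q1)) (l j).
Hypothesis l2 : forall j, spectrum_listing (Lj j (p2, q2)) (l j).

Let tau := 32 * eps / gam.
Let gam0 : 0 < gam. Proof. by case: G. Qed.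
Let eg32 : 32 * eps <= gam. Proof. by move: eg e0; lra. Qed.

(** A spectral point of the first operator near [Lam n] is, by the common listing, an eigenvalue of
    both. Each eigenfunction is tested in the other equation; normalizing the derivatives by [kap n]
    leaves the factor [kap n ^ 2]. *)
Lemma eigen_products j n : 1 <= (kap j n : R) -> exists u v w t : R -> R,
  [/\ [/\ cont01 u, cont01 v, cont01 w & cont01 t],
      forall x, 0 <= x <= 1 -> [/\ `|u x - cosj j n x| <= tau / kap j n,
         `|v x - cosj j n x| <= tau / kap j n, `|w x - sinj j n x| <= tau / kap j n &
         `|t x - sinj j n x| <= tau / kap j n] &
      kap j n ^+ 2 * ip (p1 - p2) (u \* v) + ip (q1 - q2) (w \* t) = 0].
Proof.
move=> kn1; have kn0 : 0 < (kap j n : R) by exact: lt_le_trans kn1.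
have [lam near spec] := spectral_point Lp1 Lq1 kn1 G e0 eg32 Pe1 Qe1.
have [k lk] := listing_spectrum (l1 j) spec.
have [u1 E1 n1] := listing_nonzero k (l1 j).
have [u2 E2 n2] := listing_nonzero k (l2 j).
rewrite lk in E1 E2.
have [y [y1 [y2 [Sy ny]]]] := eigen_weak n E1 n1.
have [z [z1 [z2 [Sz nz]]]] := eigen_weak n E2 n2.
have [b b0 Hb] := eigen_normalized Lp1 Lq1 kn1 G e0 eg32 Pe1 Qe1 near Sy ny.
have [c c0 Hc] := eigen_normalized Lp2 Lq2 kn1 G e0 eg32 Pe2 Qe2 near Sz nz.
have [Ay Fy] := Sy; have [Az Fz] := Sz.
have cy := adm_cont Ay; have cy1 := adm_cont1 Ay.
have cz := adm_cont Az; have cz1 := adm_cont1 Az.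
exists ((kap j n * b)^-1 *: y1), ((kap j n * c)^-1 *: z1), (b^-1 *: y), (c^-1 *: z);
  split.
- by split; exact: cont01Z.
- by move=> x xI; have [? ?] := Hb x xI; have [? ?] := Hc x xI; split.
have L1 : realL2 (y1 \* z1) by apply: cont01_realL2; exact: cont01M.
have L0 : realL2 (y \* z) by apply: cont01_realL2; exact: cont01M.
have LP : realL2 (p1 - p2) by exact: realL2B.
have LQ : realL2 (q1 - q2) by exact: realL2B.
have sc (r s : R) (g h : R -> R) : (r *: g) \* (s *: h) = (r * s) *: (g \* h).
  by apply/funext => x; rewrite /= !scalefE /=; ring.
rewrite !sc !ipZr//.
have key : ip (p1 - p2) (y1 \* z1) + ip (q1 - q2) (y \* z) = 0.
  have := Fy _ _ _ Az; have := Fz _ _ _ Ay; rewrite /wform !scale0r !ip0l !add0r.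
  have mv (f g h : R -> R) : ip (f \* g) h = ip f (g \* h).
    by congr rint; apply/funext => x /=; rewrite mulrA.
  rewrite !mv (ipC z2) (ipC z y) ipBl// ipBl//.
  have sw (g h : R -> R) : g \* h = h \* g by apply/funext => x /=; rewrite mulrC.
  rewrite (sw z1) (sw z y); lra.
rewrite (_ : _ + _ = (b * c)^-1 * (ip (p1 - p2) (y1 \* z1) + ip (q1 - q2) (y \* z))).
  by rewrite key mulr0.
by field; rewrite b0 c0 lt0r_neq0.
Qed.

(** Interleaves the two families, Dirichlet for even [m] and Dirichlet-Neumann for odd [m]; squaring
    doubles the frequency to [pi m], so all [cosm m] are reached. *)
Let kap_odd m : kap (odd m) m./2 = pi * m%:R / 2 :> R.
Proof. by rewrite /kap addnC odd_double_half. Qed.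

Let kap_ge m : m%:R <= (kap (odd m) m./2 : R).
Proof.
rewrite kap_odd mulrAC ler_peMl// ler_pdivlMr// mul1r.
exact: pi_ge2.
Qed.

Let tau0 : 0 < tau. Proof. by rewrite divr_gt0// mulr_gt0. Qed.
Let tau1 : tau <= 32 / 1000.
Proof. by rewrite /tau ler_pdivrMr//; move: eg; lra. Qed.

Let bound (m : nat) : tau / kap (odd m.+1) m.+1./2 <= tau / m.+1%:R.
Proof.
have kp := lt_le_trans (ltr0Sn R m) (kap_ge m.+1).
by rewrite ler_wpM2l ?(ltW tau0)// lef_pV2 ?posrE ?ltr0n ?(kap_ge m.+1).
Qed.

Let kap1 (m : nat) : 1 <= (kap (odd m.+1) m.+1./2 : R).
Proof. by apply: le_trans (kap_ge _); rewrite ler1n. Qed.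

Let tau_m (m : nat) : tau / m.+1%:R <= 1.
Proof.
rewrite ler_pdivrMr ?ltr0n// mul1r (@le_trans _ _ 1)// ?ler1n//.
by move: tau1; lra.
Qed.

Let dbl m (x : R) : kap (odd m) m./2 * x *+ 2 = pi * m%:R * x.
Proof. by rewrite kap_odd; field. Qed.

Let cos_sqr m : cosj (odd m) m./2 \* cosj (odd m) m./2 = 2^-1 *: (cosm 0 + cosm m) :>
  (R -> R).
Proof.
apply/funext => x; rewrite scalefE addfE /cosm /cosj /cosx/= mulr0 mul0r cos0.
by rewrite -dbl cos_mulr2n; field.
Qed.

Let sin_sqr m : sinj (odd m) m./2 \* sinj (odd m) m./2 = 2^-1 *: (cosm 0 - cosm m) :>
  (R -> R).
Proof.
apply/funext => x; rewrite scalefE addfE oppfE /cosm /sinj /sinx/= mulr0 mul0r cos0.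
by rewrite -dbl cos_mulr2n -expr2 sin2cos2; field.
Qed.

Let Lcm m : realL2 (cosm m : R -> R).
Proof. by rewrite cosm_cosj; exact: realL2_cosx. Qed.

Let contc j n : cont01 (cosj j n : R -> R).
Proof. by apply: continuous_cont01; exact: continuous_cosx. Qed.

Let conts j n : cont01 (sinj j n : R -> R).
Proof. by apply: continuous_cont01; exact: continuous_sinx. Qed.

Let ae_eq_ip f g h : realL2 f -> realL2 g -> realL2 h -> ae01 f g -> ip (f - g) h = 0.
Proof. by move=> Lf Lg Lh fg; rewrite ipBl// (ae_ip Lf Lg Lh fg) subrr. Qed.

Let ip0_ae f g : realL2 f -> realL2 g -> ip (f - g) (f - g) = 0 -> ae01 f g.
Proof.
move=> Lf Lg /(ip_eq0_ae (realL2B Lf Lg)); apply: ae01S => x _ /eqP.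
by rewrite addfE oppfE subr_eq0 => /eqP.
Qed.

(** The smallness of [eps] enters here: [tau <= 0.032] gives [12 tau < 1]. The 6 is 3 from
    [product_estimate] times 2 from the half in [cos_sqr] and [sin_sqr]. *)
Let tau6 : (6 * tau) ^+ 2 * 4 < 1.
Proof. by move: tau0 tau1; nra. Qed.

(** Only the derivative term of [eigen_products] survives, and its product is close to
    [(1 + cosm m) / 2], which calls for the sign 1. *)
Lemma isospectral_q_eq : ae01 q1 q2 -> ae01 p1 p2.
Proof.
move=> qq; apply: ip0_ae => //; have Lf := realL2B Lp1 Lp2.
apply: (@perturbed_cos_complete _ 1 (6 * tau)) => //;
  [by rewrite expr1n|by rewrite mulr_ge0// ltW|].
move=> m; have [u [v [w [t [[cu cv cw ct] H E]]]]] := eigen_products (kap1 m).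
have uv0 : ip (p1 - p2) (u \* v) = 0.
  move/eqP: E; rewrite (ae_eq_ip Lq1 Lq2 (cont01_realL2 (cont01M cw ct)) qq) addr0.
  by rewrite mulf_eq0 expf_eq0 /= (gt_eqF (lt_le_trans ltr01 (kap1 m))) => /eqP.
have := @product_estimate (p1 - p2) _ u v (tau / m.+1%:R) Lf (@contc (odd m.+1)
  m.+1./2) cu cv (tau_m m) _ uv0.
rewrite cos_sqr ipZr//; last exact: realL2D.
rewrite ipDr// normrM mul1r => P.
have {P} : `|2^-1| * `|ip (p1 - p2) (cosm 0) + ip (p1 - p2) (cosm m.+1)| <= nrm (p1 -
  p2) * (3 * (tau / m.+1%:R)).
  apply: P => x xI; have [H1 H2 _ _] := H x xI.
  by rewrite cos_max (le_trans H1 (bound m)) (le_trans H2 (bound m)).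
rewrite ger0_norm ?invr_ge0//; set X := tau / _; set Y := `|_|; set Z := nrm _.
by rewrite -(mulrA 6) -/X; lra.
Qed.

(** Only the term in [q1 - q2] survives, with a product close to [(1 - cosm m) / 2], hence the sign
    -1. *)
Lemma isospectral_p_eq : ae01 p1 p2 -> ae01 q1 q2.
Proof.
move=> pp; apply: ip0_ae => //; have Lf := realL2B Lq1 Lq2.
apply: (@perturbed_cos_complete _ (-1) (6 * tau)) => //;
  [by rewrite sqrrN expr1n|by rewrite mulr_ge0// ltW|].
move=> m; have [u [v [w [t [[cu cv cw ct] H E]]]]] := eigen_products (kap1 m).
have wt0 : ip (q1 - q2) (w \* t) = 0.
  by move: E; rewrite (ae_eq_ip Lp1 Lp2 (cont01_realL2 (cont01M cu cv)) pp) mulr0 add0r.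
have := @product_estimate (q1 - q2) _ w t (tau / m.+1%:R) Lf (@conts (odd m.+1)
  m.+1./2) cw ct (tau_m m) _ wt0.
rewrite sin_sqr ipZr//; last exact: realL2B.
rewrite ipBr// normrM mulN1r => P.
have {P} : `|2^-1| * `|ip (q1 - q2) (cosm 0) - ip (q1 - q2) (cosm m.+1)| <= nrm (q1 -
  q2) * (3 * (tau / m.+1%:R)).
  apply: P => x xI; have [_ _ H1 H2] := H x xI.
  by rewrite sin_max (le_trans H1 (bound m)) (le_trans H2 (bound m)).
rewrite ger0_norm ?invr_ge0//; set X := tau / _; set Y := `|_|; set Z := nrm _.
by rewrite -(mulrA 6) -/X; lra.
Qed.

End IsoSpectral.

Lemma ball_nrm (a1 a2 eps : R) p q : E2ball (fun=> a1, fun=> a2) eps (p, q) ->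
  [/\ realL2 p, realL2 q, nrm (p \- (fun=> a1)) <= eps & nrm (q \- (fun=> a2)) <= eps].
Proof.
move=> [[/= Lp Lq]]; rewrite /E2norm /= => H.
have e0 : 0 < eps by apply: le_lt_trans H; exact: sqrtr_ge0.
have LP : realL2 (p \- (fun=> a1)) by apply: realL2B => //; exact: realL2_cst.
have LQ : realL2 (q \- (fun=> a2)) by apply: realL2B => //; exact: realL2_cst.
move: H; rewrite !realL2norm_sqr// => H.
have {}H : ip (p \- (fun=> a1)) (p \- (fun=> a1)) + ip (q \- (fun=> a2)) (q \- (fun=>
  a2)) < eps ^+ 2.
  by rewrite -(sqr_sqrtr (addr_ge0 (ip_ge0 _) (ip_ge0 _))) ltr_sqr ?nnegrE
    ?sqrtr_ge0// ltW.
have P0 := ip_ge0 (p \- (fun=> a1)); have Q0 := ip_ge0 (q \- (fun=> a2)).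
by split=> //; rewrite -ler_sqr ?nnegrE ?nrm_ge0 ?(ltW e0)// nrm_sqr; lra.
Qed.

End Conclusion.

Theorem theorem1p1 (R : realType) (a1 a2 : R)
    (aW : W ((fun=> a1), (fun=> a2))) :
  exists eps : R, 0 < eps /\
    forall p1 q1 p2 q2 : R -> R,
      E2ball ((fun=> a1), (fun=> a2)) eps (p1, q1) ->
      E2ball ((fun=> a1), (fun=> a2)) eps (p2, q2) ->
      forall lambda1 lambda2 mu1 mu2 : nat -> R,
        spectrum_listing (L_1 (p1, q1)) lambda1 ->
        spectrum_listing (L_1 (p2, q2)) lambda2 ->
        spectrum_listing (L_2 (p1, q1)) mu1 ->
        spectrum_listing (L_2 (p2, q2)) mu2 ->
        (forall n, lambda1 n = lambda2 n) ->
        (forall n, mu1 n = mu2 n) ->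
        (ae01 q1 q2 -> ae01 p1 p2) /\ (ae01 p1 p2 -> ae01 q1 q2).
Proof.
have [_ W1 W2] := aW.
have [|gam G] := @gap_exists R a1.
  by case; [exact: (@simple_nondegenerate R true a1 a2 W2)|exact:
    (@simple_nondegenerate R false a1 a2 W1)].
have gam0 : 0 < gam by case: G.
have e0 : 0 < gam / 1000 by lra.
exists (gam / 1000); split; first exact: e0.
move=> p1 q1 p2 q2 /ball_nrm[Lp1 Lq1 P1 Q1] /ball_nrm[Lp2 Lq2 P2 Q2].
(* Isospectrality makes the listings equal as functions, so one family [l] serves both pairs. *)
move=> la1 la2 mu1 mu2 S1 S2 T1 T2 /funext la /funext mu; subst la2 mu2.
pose l (j : bool) := if j then mu1 else la1.
have l1 j : spectrum_listing (Lj j (p1, q1)) (l j) by case: j.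
have l2 j : spectrum_listing (Lj j (p2, q2)) (l j) by case: j.
have eg : 1000 * (gam / 1000) <= gam by lra.
split.
  exact: (isospectral_q_eq Lp1 Lq1 Lp2 Lq2 G e0 eg P1 Q1 P2 Q2 l1 l2).
exact: (isospectral_p_eq Lp1 Lq1 Lp2 Lq2 G e0 eg P1 Q1 P2 Q2 l1 l2).
Qed.
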